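(* Let $\Omega \subset \mathbb R^d$ be nonempty, open, bounded and connected, and suppose that there exists $D > 0$ such that any two points $x, y \in \bar\Omega$ can be connected by a curve included in $\bar\Omega$ of length at most $D |x - y|$. Let $\Gamma \subset \bar\Omega$ be nonempty and closed. Let $K: \mathcal P(\bar\Omega) \times \bar\Omega \to \mathbb R_+$ be continuous and such that there exist positive constants $K_{\min}, K_{\max}$ with $K(\mu,x) \in [K_{\min}, K_{\max}]$ for every $(\mu,x)$, and a constant $L > 0$ with $|K(\mu,x_1) - K(\mu,x_2)| \le L |x_1 - x_2|$ for every $\mu \in \mathcal P(\bar\Omega)$ and $x_1, x_2 \in \bar\Omega$. Let $m_0 \in \mathcal P(\bar\Omega)$. A measure $Q \in \mathcal P(\mathbf C(\bar\Omega))$ is an equilibrium of $\mathrm{MFG}(K)$ with initial condition $m_0$ if and only if $e_{0\#} Q = m_0$ and every $\gamma \in \mathrm{supp}(Q)$ satisfies $\gamma \in \mathrm{Opt}(k_Q, 0, \gamma(0))$, where $k_Q: \mathbb R_+ \times \bar\Omega \to \mathbb R_+$ is defined by $k_Q(t,x) = K(e_{t\#} Q, x)$.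
   Context: $\mathbb R_+ = [0,\infty)$, $\bar B$ is the closed unit ball of $\mathbb R^d$. $\mathbf C(\bar\Omega)$ is the set of continuous functions $\mathbb R_+ \to \bar\Omega$ with the topology of uniform convergence on compact sets (a Polish space); $e_t: \mathbf C(\bar\Omega) \to \bar\Omega$, $e_t(\gamma) = \gamma(t)$; $f_\#\mu$ denotes push-forward. For a Polish space $X$, $\mathcal P(X)$ is the set of Borel probability measures on $X$ with the topology of weak (narrow) convergence, and $\mathrm{supp}(\mu)$ is the set of points all of whose open neighborhoods have positive $\mu$-measure. For $k: \mathbb R_+ \times \bar\Omega \to \mathbb R_+$, $\mathrm{Adm}(k)$ is the set of Lipschitz continuous $\gamma: \mathbb R_+ \to \bar\Omega$ for which there is a measurable $u: \mathbb R_+ \to \bar B$ with $\dot\gamma(t) = k(t, \gamma(t)) u(t)$ for a.e. $t \ge 0$. For a Lipschitz curve $\gamma$ and $t_0 \ge 0$, $\tau(t_0, \gamma) = \inf\{t \ge 0 : \gamma(t + t_0) \in \Gamma\}$ ($+\infty$ if there is no such $t$). $\mathrm{Opt}(k, t_0, x_0)$ is the set of $\gamma \in \mathrm{Adm}(k)$ such that $\gamma(t) = x_0$ for $t \in [0, t_0]$, $\tau(t_0, \gamma) = \inf\{\tau(t_0, \beta): \beta \in \mathrm{Adm}(k),\ \beta(t_0) = x_0\}$, and $\gamma(t) = \gamma(t_0 + \tau(t_0, \gamma))$ for all $t \ge t_0 + \tau(t_0, \gamma)$. A measure $Q \in \mathcal P(\mathbf C(\bar\Omega))$ is an equilibrium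 (Lagrangian equilibrium) of $\mathrm{MFG}(K)$ with initial condition $m_0$ if $e_{0\#} Q = m_0$ and $Q$-almost every $\gamma \in \mathbf C(\bar\Omega)$ satisfies $\gamma \in \mathrm{Opt}(k_Q, 0, \gamma(0))$, where $k_Q(t,x) = K(e_{t\#} Q, x)$. *)

(* Defs.v *)
From HB Require Import structures.
From mathcomp Require Import all_boot all_order all_algebra.
From mathcomp Require Import all_classical all_reals all_analysis.

Set Implicit Arguments.
Unset Strict Implicit.
Unset Printing Implicit Defensive.
Import Order.TTheory GRing.Theory Num.Theory.
Import numFieldNormedType.Exports.

Local Open Scope classical_set_scope.
Local Open Scope ring_scope.

(* The norm of the library on ['rV[R]_d] is the sup norm: it induces the usual
   topology of R^d, but metric quantities need the Euclidean norm. *)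
Definition enorm (R : realType) (d : nat) (v : 'rV[R]_d) : R :=
  Num.sqrt (\sum_(i < d) v ord0 i ^+ 2).

(* Same sums as in the library's [variation], which is restricted to
   real-valued functions. *)
Definition curve_length (R : realType) (d : nat) (a b : R)
    (c : R -> 'rV[R]_d) : \bar R :=
  ereal_sup [set (let F := c \o nth b (a :: s) in
    \sum_(0 <= n < size s) enorm (F n.+1 - F n))%:E | s in itv_partition a b].

Definition geodesic_bound (R : realType) (d : nat) (A : set 'rV[R]_d) (D : R) :=
  forall x y : 'rV[R]_d, A x -> A y -> exists c : R -> 'rV[R]_d,
    [/\ {within `[0, 1], continuous c}, c 0 = x, c 1 = y,
        c @` `[0, 1] `<=` A &
        (curve_length 0 1 c <= (D * enorm (x - y))%:E)%E].

Notation borel X := (g_sigma_algebraType (@open X)).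

Section probability_space.
Context (R : realType) (X : ptopologicalType).

(* Elements of this type that agree on all Borel sets may still differ as
   functions on [set X], hence measures are compared on Borel sets only; such
   elements are topologically indistinguishable for the topology below. *)
Definition Prob : Type := probability (borel X) R.

Definition eq_prob (mu nu : Prob) :=
  forall A : set (borel X), measurable A -> mu A = nu A.

Definition supp (mu : Prob) : set X :=
  [set x | forall U : set X, open U -> U x -> (0 < mu U)%E].

Definition test_fun : Type :=
  {f : X -> R | continuous f /\ [bounded f x | x in [set: X]]}.

Definition integrate (f : test_fun) (mu : Prob) : R :=
  \int[mu]_(x in [set: borel X]) (sval f x).

End probability_space.

Section narrow_topology.
Context (R : realType) (X : ptopologicalType).

HB.instance Definition _ := Choice.on (Prob R X).

(* Coarsest topology for which mu |-> \int f dmu is continuous for every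
   bounded continuous f. *)
HB.instance Definition _ := Topological.copy (Prob R X)
  (sup_topology (fun f : test_fun R X =>
    Topological.on (initial_topology (integrate f)))).

End narrow_topology.

Definition Rplus (R : realType) : Type := set_type `[0 : R, +oo[%classic.

HB.instance Definition _ (R : realType) :=
  PseudoMetric.copy (Rplus R) (set_type `[0 : R, +oo[%classic).

Definition rplus_val (R : realType) (t : Rplus R) : R := \val t.

Fact rplus_subproof (R : realType) (t : R) :
  Num.max 0 t \in `[0 : R, +oo[%classic.
Proof. by rewrite inE /= in_itv /= andbT le_max lexx. Qed.

(* The retraction of R onto R_+: it is only meant to be used at t >= 0, where
   it is the identity, and to extend functions on R_+ to R. *)
Definition rplus (R : realType) (t : R) : Rplus R :=
  exist (fun x => x \in `[0 : R, +oo[%classic) _ (rplus_subproof t).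

(* The library's measurable types are pointed, hence the type of points of the
   closure depends on a proof that [Omega] is nonempty. *)
Definition cldom (R : realType) (d : nat) (Omega : set 'rV[R]_d)
  (_ : Omega !=set0) : Type := set_type (closure Omega).

Section domain.
Context (R : realType) (d : nat) (Omega : set 'rV[R]_d).
Variable Omega0 : Omega !=set0.

HB.instance Definition _ :=
  PseudoMetric.copy (cldom Omega0) (set_type (closure Omega)).

Definition cldom_val (x : cldom Omega0) : 'rV[R]_d := \val x.

Definition cldom_point : cldom Omega0 :=
  exist (fun x => x \in closure Omega) _
    (mem_set (@subset_closure _ Omega _ (projT2 (cid Omega0)))).

HB.instance Definition _ := isPointed.Build (cldom Omega0) cldom_point.

Definition paths : Type := continuousType (Rplus R) (cldom Omega0).

HB.instance Definition _ := Choice.on paths.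

Definition path_fun (g : paths) : {family compact, Rplus R -> cldom Omega0} :=
  fun t => (g : continuousType _ _) t.

(* [{family compact, _ -> _}] carries the topology of uniform convergence on
   compact sets. *)
HB.instance Definition _ := Topological.copy paths (initial_topology path_fun).

Fact path_point_continuous : continuous (fun _ : Rplus R => cldom_point).
Proof. exact: cst_continuous. Qed.

Definition paths_point : paths := mkcts path_point_continuous.

HB.instance Definition _ := isPointed.Build paths paths_point.

Definition eval_at (t : Rplus R) : borel paths -> borel (cldom Omega0) :=
  fun g => path_fun g t.

Lemma continuous_eval_at (t : Rplus R) :
  continuous (eval_at t : paths -> cldom Omega0).
Proof.
move=> g.
have ct := pointwise_cvg_compact_family
  (nbhs_filter (path_fun g)) (@cvg_id _ (nbhs (path_fun g))).
have := (pointwise_cvgP (path_fun g) (nbhs_filter (path_fun g))).1 ct t.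
exact: cvg_comp (@initial_continuous _ _ path_fun g).
Qed.

Lemma measurable_eval_at (t : Rplus R) : measurable_fun setT (eval_at t).
Proof.
apply: (@measurability _ _ (borel paths) (borel (cldom Omega0)) setT (eval_at t)
  (@open (cldom Omega0))) => // _ [U oU <-].
rewrite setTI; apply: sub_sigma_algebra.
by move: U oU; apply/continuousP; exact: continuous_eval_at.
Qed.

HB.instance Definition _ (t : Rplus R) :=
  isMeasurableFun.Build _ _ _ _ (eval_at t) (measurable_eval_at t).

Definition push_eval (t : Rplus R) (Q : Prob R paths) : Prob R (cldom Omega0) :=
  distribution Q (eval_at t).

Definition curve : Type := Rplus R -> cldom Omega0.

Definition in_space (g : curve) (t : R) : 'rV[R]_d := cldom_val (g (rplus t)).

Definition lipschitz_curve (g : curve) :=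
  exists M : R, forall s t : Rplus R,
    enorm (cldom_val (g s) - cldom_val (g t)) <=
    M * `|rplus_val s - rplus_val t|.

(* The control u : R_+ -> \bar B is given as a function on R of which only the
   restriction to [0, +oo[ is used; the a.e. condition does not see t = 0,
   where [in_space g] would not have the right derivative. *)
Definition Adm (k : Rplus R -> cldom Omega0 -> R) : set curve :=
  [set g | lipschitz_curve g /\
    exists u : R -> borel 'rV[R]_d,
      [/\ measurable_fun `[0 : R, +oo[ u,
          forall t, 0 <= t -> enorm (u t : 'rV[R]_d) <= 1 &
          {ae lebesgue_measure, forall t : R, 0 <= t ->
            is_derive t 1 (in_space g)
              (k (rplus t) (g (rplus t)) *: (u t : 'rV[R]_d))}]].

Definition exit_time (Gamma : set 'rV[R]_d) (t0 : Rplus R) (g : curve) : \bar R :=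
  ereal_inf [set t%:E | t in
    [set t : R | 0 <= t /\ Gamma (in_space g (t + rplus_val t0))]].

Definition Opt (Gamma : set 'rV[R]_d) (k : Rplus R -> cldom Omega0 -> R)
    (t0 : Rplus R) (x0 : cldom Omega0) : set curve :=
  [set g | [/\ Adm k g,
      forall t, rplus_val t <= rplus_val t0 -> g t = x0,
      exit_time Gamma t0 g =
        ereal_inf [set exit_time Gamma t0 b | b in
          [set b | Adm k b /\ b t0 = x0]] &
      forall t,
        ((rplus_val t0)%:E + exit_time Gamma t0 g <= (rplus_val t)%:E)%E ->
        g t = g (rplus (rplus_val t0 + fine (exit_time Gamma t0 g)))]].

Definition kQ (K : Prob R (cldom Omega0) -> cldom Omega0 -> R)
    (Q : Prob R paths) (t : Rplus R) (x : cldom Omega0) : R :=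
  K (push_eval t Q) x.

Definition is_equilibrium (Gamma : set 'rV[R]_d)
    (K : Prob R (cldom Omega0) -> cldom Omega0 -> R)
    (m0 : Prob R (cldom Omega0)) (Q : Prob R paths) :=
  eq_prob (push_eval (rplus 0) Q) m0 /\
  {ae Q, forall g : paths,
    Opt Gamma (kQ K Q) (rplus 0) (path_fun g (rplus 0)) (path_fun g)}.

End domain.

(* Main.v *)
From HB Require Import structures.
Require Import Defs.
From mathcomp Require Import all_boot all_order all_algebra.
From mathcomp Require Import all_classical all_reals all_analysis.
From mathcomp Require Import measurable_realfun ring lra.

(** The set [O] of optimal curves for [kQ K Q] has full measure for an equilibrium
    [Q], and the claim is that having full measure is the same as containing the
    support of [Q].

    One direction holds for every set: the complement of the support is
    negligible ([supp_full]), because the paths are covered, at every scale, by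
    countably many small sets.

    For the other direction it suffices that [O] be closed: every neighbourhood of
    a point of the support has positive measure, hence meets [O]. Two facts give
    closedness.

    - Admissibility passes to limits. It is equivalent to [speed_bounded]: on any
      time interval where [k] is at most [M] along the curve, the curve is
      [M]-Lipschitz. From left to right this is the fact that a Lipschitz function
      with nonpositive derivative almost everywhere is nonincreasing
      ([lipschitz_ae_nonincreasing]). From right to left the curve is
      derivable almost everywhere ([lipschitz_ae_derivable]) and the control is
      its velocity divided by [k]. The equivalence uses that [k] is continuous
      along the curve, which holds since [t |-> push_eval t Q] is continuous for the
      narrow topology ([continuous_push_eval]).

    - Optimality passes to limits, because the minimal exit time is upper
      semicontinuous in the starting point ([reach_nearby], [Opt_exit_near]). From
      a point [y] close to [b 0], one walks to [b 0] and then follows [b]. As [k] is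
      only continuous in time, one cannot follow [b] with a constant delay;
      [delayed_clock] gives an explicit delay that grows like
      [expR (L * t)], keeps the speed admissible, and tends to 0 with the
      distance of [y] to [b 0]. An optimal curve that starts close to [g 0] hence
      stops in [Gamma] not much later than any competitor of [g], so that the same
      is true of the limit [g]. Applied to [g] itself, this shows that [g] does not
      move after its exit time ([Opt_limit]). *)

Set Implicit Arguments.
Unset Strict Implicit.
Unset Printing Implicit Defensive.
Import Order.TTheory GRing.Theory Num.Theory.
Import numFieldNormedType.Exports.

Local Open Scope classical_set_scope.
Local Open Scope ring_scope.

(** * Real functions and their derivatives *)

Lemma max_contract (R : realDomainType) (a x y : R) :
  `|Num.max a x - Num.max a y| <= `|x - y|.
Proof.
case: (leP a x) => ax; case: (leP a y) => ay //.
- by rewrite !ger0_norm; lra.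
- by rewrite ler0_norm ?[leRHS]ler0_norm; lra.
- by rewrite subrr normr0.
Qed.

Lemma lipschitz_continuous (R : realType) (f : R -> R) (C : R) :
  (forall x y, `|f x - f y| <= C * `|x - y|) -> continuous f.
Proof.
move=> lipf x; apply/cvgrPdist_le => /= eps eps0.
have C1 : 0 < `|C| + 1 by rewrite ltr_wpDl.
exists (eps / (`|C| + 1)); first by rewrite /= divr_gt0.
move=> y /= xy; apply: le_trans (lipf _ _) _.
apply: (@le_trans _ _ ((`|C| + 1) * `|x - y|)).
  by rewrite ler_wpM2r// (le_trans (ler_norm C))// lerDl.
by rewrite mulrC -ler_pdivlMr// ltW.
Qed.

(** The set of points of [[a, b]] where [H <= H a] is closed, and local
    monotonicity to the right prevents its supremum from being less than [b]. *)
Lemma locally_nonincreasing (R : realType) (H : R -> R) (a b : R) :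
  continuous H -> a <= b ->
  (forall x, a <= x < b -> \forall y \near x, x <= y -> H y <= H x) ->
  H b <= H a.
Proof.
move=> cH ab loc; rewrite leNgt; apply/negP => Hab.
pose S := [set x | a <= x <= b /\ H x <= H a].
have Sa : S a by split; rewrite ?lexx.
have ubS : ubound S b by move=> x [/andP[]].
have hsS : has_sup S by split; [exists a | exists b].
have cS : closed S.
  have -> : S = `[a, b]%classic `&` H @^-1` `]-oo, H a]%classic.
    by apply/seteqP; split => x; rewrite /S /= !in_itv.
  apply: closedI; first exact: itv_closed.
  by apply: preimage_closed => //; move=> x _; exact: cH.
have [scab Hsa] : S (sup S).
  by apply: cS; apply: closure_sup; [exists a | exists b].
have supb : sup S < b.
  case/andP: scab => _; rewrite le_eqVlt => /predU1P[eb|//].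
  by move: Hab; rewrite ltNge -eb Hsa.
case/andP: (scab) => asup _.
have := loc (sup S); rewrite asup supb => /(_ isT) locS.
have locR : \forall y \near (sup S)^'+, sup S <= y -> H y <= H (sup S).
  exact: (@cvg_within _ (nbhs (sup S))).
have : \forall y \near (sup S)^'+, [/\ y <= b, sup S < y & H y <= H (sup S)].
  near=> y; split.
  - by near: y; exact: nbhs_right_le.
  - by near: y; exact: nbhs_right_gt.
  - have sy : sup S <= y by near: y; exact: nbhs_right_ge.
    by apply: (near locR y) => //; near: y.
move=> /filter_ex[y [yb sy Hy]].
have : S y by split; [rewrite (le_trans asup (ltW sy))|exact: le_trans Hy Hsa].
by move/(ub_le_sup (proj2 hsS)); rewrite leNgt sy.
Unshelve. all: by end_near. Qed.

Lemma cvg_quotient (R : realType) (V : normedModType R) (f : R -> V) (t : R) (w : V) :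
  is_derive t 1 f w -> h^-1 *: (f (h + t) - f t) @[h --> 0^'] --> w.
Proof.
move=> [der <-]; move: der; rewrite /derivable /derive.
by under eq_fun do rewrite [_ *: 1]mulr1.
Qed.

Lemma antiderivative (R : realType) (f : R -> R) : continuous f ->
  exists2 F : R -> R, F 0 = 0 & forall t : R, 0 <= t -> is_derive t 1 F (f t).
Proof.
move=> cf.
(* Integrating from -1 makes 0 an interior point of the interval. *)
pose F0 x := (\int[lebesgue_measure]_(t in `](-1)%R, x]) (f t))%R.
have dF (t : R) : 0 <= t -> is_derive t 1 F0 (f t).
  move=> t0.
  have fint : lebesgue_measure.-integrable `](-1)%R, t + 1] (EFin \o f).
    have full : lebesgue_measure.-integrable `[-1, t + 1] (EFin \o f).
      apply: continuous_compact_integrable; first exact: segment_compact.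
      exact: continuous_subspaceT.
    apply: integrableS full => //.
    by apply: subset_itvr; rewrite bnd_simp.
  have tt1 : t < t + 1 by rewrite ltrDl.
  have t1 : ((BRight (-1) : itv_bound R) < BRight t)%O by rewrite bnd_simp; lra.
  have [der E] := continuous_FTC1 tt1 fint t1 (cf t).
  by split; [exact: der|rewrite -derive1E; exact: E].
exists (fun t => F0 t - F0 0); first by rewrite subrr.
move=> t t0; have := dF t t0 => d0.
by rewrite -[f t]subr0; apply: is_deriveB.
Qed.

Lemma MVT_le (R : realType) (f f' : R -> R) (s t M : R) : s <= t ->
  (forall r : R, s <= r <= t -> is_derive r 1 f (f' r)) ->
  (forall r, s <= r <= t -> f' r <= M) -> f t - f s <= M * (t - s).
Proof.
rewrite le_eqVlt => /predU1P[-> _ _|st df fM]; first by rewrite !subrr mulr0.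
have [||c] := @MVT R f f' s t st.
- by move=> r /[!in_itv]/= /andP[h1 h2]; apply: df; rewrite !ltW.
- apply: derivable_within_continuous => r /[!in_itv]/= h.
  by have [] := df r h.
move=> /[!in_itv]/= /andP[h1 h2] ->.
by rewrite ler_wpM2r ?subr_ge0 ?(ltW st)// fM// !ltW.
Qed.

(** A primitive of the indicator function of [U], vanishing at [a]. *)
Definition clip_length (R : realType) (U : set R) (a x : R) : R :=
  fine (lebesgue_measure (U `&` `]a, x]%classic)).

Lemma clip_length_diff (R : realType) (U : set R) (a x y : R) :
  measurable U -> a <= x -> x <= y ->
  clip_length U a y = clip_length U a x + fine (lebesgue_measure (U `&` `]x, y]%classic)).
Proof.
move=> mU ax xy; rewrite /clip_length.
have fin u v : u <= v -> lebesgue_measure (U `&` `]u, v]%classic) \is a fin_num.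
  move=> uv; rewrite ge0_fin_numE//.
  apply: (@le_lt_trans _ _ (lebesgue_measure `]u, v]%classic)).
    apply: le_measure; rewrite ?inE//; exact: measurableI.
  by rewrite lebesgue_measure_itv/= lte_fin; case: ifP => _; rewrite ?ltry// -EFinB ltry.
rewrite -fineD ?fin//; congr fine.
rewrite -measureU//; [|exact: measurableI..|].
  rewrite -setIUr; congr (lebesgue_measure (_ `&` _)).
  apply/seteqP; split => z; rewrite /= !in_itv/=.
    by move=> /andP[az zy]; have [|] := leP z x; rewrite ?az ?zy; [left|right].
  by move=> [|] /andP[h1 h2]; rewrite ?h1 ?h2 ?(le_trans h2 xy) ?(le_lt_trans ax h1).
apply/seteqP; split => z //= -[[_ +] [_]]; rewrite !in_itv/=.
by move=> /andP[_ zx] /andP[]; rewrite ltNge zx.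
Qed.

Lemma clip_length_bounds (R : realType) (U : set R) (a x y : R) :
  measurable U -> a <= x -> x <= y ->
  0 <= clip_length U a y - clip_length U a x <= y - x.
Proof.
move=> mU ax xy; rewrite (clip_length_diff mU ax xy) addrC addKr.
rewrite fine_ge0//=.
have -> : y - x = fine (lebesgue_measure `]x, y]%classic).
  rewrite lebesgue_measure_itv/= lte_fin; case: ltP => //= yx.
  by apply/eqP; rewrite subr_eq0 eq_le yx.
have finxy : lebesgue_measure `]x, y]%classic \is a fin_num.
  by rewrite lebesgue_measure_itv/= lte_fin; case: ifP => // _; rewrite -EFinB.
have le : (lebesgue_measure (U `&` `]x, y]) <= lebesgue_measure `]x, y]%classic)%E.
  by apply: le_measure; rewrite ?inE//; exact: measurableI.
apply: fine_le => //.
by rewrite ge0_fin_numE// (le_lt_trans le)// -ge0_fin_numE.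
Qed.

Lemma clip_length_in (R : realType) (U : set R) (a x y : R) :
  measurable U -> a <= x -> x <= y -> `]x, y]%classic `<=` U ->
  clip_length U a y - clip_length U a x = y - x.
Proof.
move=> mU ax xy sub; rewrite (clip_length_diff mU ax xy) addrC addKr.
rewrite (setIidr sub) lebesgue_measure_itv/= lte_fin; case: ltP => //= yx.
by apply/eqP; rewrite eq_sym subr_eq0 eq_le yx.
Qed.

(** Over a cover of the exceptional null set by an open set [U] of small
    measure, the growth of [f] is paid by the Lipschitz constant times
    [clip_length U]; elsewhere the derivative is nonpositive. So
    [f - e * id - C * clip_length U] is locally nonincreasing. *)
Lemma lipschitz_ae_nonincreasing (R : realType) (f : R -> R) (C a b : R) :
  0 <= C -> a <= b -> (forall x y, `|f x - f y| <= C * `|x - y|) ->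
  {ae lebesgue_measure, forall t, a <= t < b ->
     exists2 v, is_derive t 1 f v & v <= 0} ->
  f b <= f a.
Proof.
move=> C0 ab lipf [N [mN N0 subN]].
apply/ler_addgt0Pr => e e0.
have cf : continuous f := lipschitz_continuous lipf.
pose e1 := e / 2 / (b - a + 1); pose e2 := e / 2 / (C + 1).
have ba0 : 0 <= b - a by rewrite subr_ge0.
have e10 : 0 < e1 by rewrite /e1 !divr_gt0// ltr_wpDl.
have e20 : 0 < e2 by rewrite /e2 !divr_gt0// ltr_wpDl.
have [U [oU NU muU]] : exists U, [/\ open U, N `<=` U &
    (lebesgue_measure U < e2%:E)%E].
  have Noo : (lebesgue_measure N < +oo)%E by rewrite [ltLHS]N0.
  have [U [oU NU muU]] := lebesgue_regularity_outer mN Noo e20.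
  exists U; split => //; apply: le_lt_trans muU.
  have mU : measurable U by exact: open_measurable.
  rewrite -[X in (lebesgue_measure X <= _)%E](setDUK NU).
  rewrite (le_trans (measureU2 _ _ _))//; first exact: measurableD.
  by rewrite [X in (X + _)%E]N0 add0e.
have mU : measurable U by exact: open_measurable.
have Gb : clip_length U a b <= e2.
  have lt2 : (lebesgue_measure (U `&` `]a, b]%classic) < e2%:E)%E.
    apply: le_lt_trans muU; apply: le_measure; rewrite ?inE//.
      exact: measurableI.
  rewrite /clip_length -lee_fin fineK; first exact: ltW.
  by rewrite ge0_fin_numE// (lt_trans lt2)// ltry.
pose m x := Num.max a x.
have ma x : a <= m x by rewrite /m le_max lexx.
pose G x := clip_length U a (m x).
have Glip x y : `|G x - G y| <= `|x - y|.
  apply: le_trans (max_contract a x y); rewrite -/(m x) -/(m y).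
  wlog xy : x y / m y <= m x => [th|].
    have [|/ltW] := leP (m y) (m x); first exact: th.
    by rewrite (distrC (G x)) (distrC (m x)); apply: th.
  rewrite ger0_norm; last by have /andP[] := clip_length_bounds mU (ma _) xy.
  have /andP[_ h] := clip_length_bounds mU (ma _) xy.
  by rewrite (le_trans h)// ler_norm.
have cG : continuous G.
  by apply: (@lipschitz_continuous _ _ 1) => x y; rewrite mul1r.
pose H x := f x - e1 * (x - a) - C * G x.
have HbHa : H b <= H a.
  apply: (@locally_nonincreasing _ H a b) => //.
    move=> x; apply: cvgB; first apply: cvgB; first exact: cf.
      by apply: cvgMr; apply: cvgB; [exact: cvg_id|exact: cvg_cst].
    by apply: cvgMr; exact: cG.
  move=> x /andP[ax xb].
  have Gmono y : x <= y -> 0 <= G y - G x.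
    move=> xy; rewrite /G.
    have mxy : m x <= m y by rewrite /m !max_r// (le_trans ax xy).
    by have /andP[] := clip_length_bounds mU (ma _) mxy.
  have [Nx|Nx] := pselect (N x).
    have /nbhs_ballP[r /= r0 sub] : nbhs x U.
      exact: open_nbhs_nbhs (conj oU (NU _ Nx)).
    exists r => //= y /= xyr xy.
    have -> : H y = H x + (f y - f x) - e1 * (y - x) - C * (G y - G x).
      by rewrite /H; ring.
    have -> : G y - G x = y - x.
      rewrite /G /m !max_r//; last exact: le_trans xy.
      apply: clip_length_in => // z; rewrite /= in_itv/= => /andP[xz zy].
      apply: sub; rewrite /ball/= distrC gtr0_norm ?subr_gt0//.
      by move: xyr; rewrite distrC ger0_norm ?subr_ge0//; lra.
    have := ler_norm (f y - f x) => h1.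
    have := lipf y x; rewrite [X in _ <= _ * X]ger0_norm ?subr_ge0// => h2.
    have : 0 <= e1 * (y - x) by rewrite mulr_ge0 ?subr_ge0// ltW.
    by lra.
  have [v fv v0] : exists2 v, is_derive x 1 f v & v <= 0.
    have : ~ (~` [set t | a <= t < b -> exists2 v, is_derive t 1 f v & v <= 0]) x.
      by move/subN.
    by move/contrapT; apply; rewrite ax xb.
  have dv := cvg_quotient fv.
  move/cvgrPdist_le : dv => /(_ _ e10)[r /= r0 dv].
  exists r => //= y /= xyr xy.
  have -> : H y = H x + (f y - f x) - e1 * (y - x) - C * (G y - G x).
    by rewrite /H; ring.
  have CG : 0 <= C * (G y - G x) by rewrite mulr_ge0// Gmono.
  move: xy; rewrite le_eqVlt => /predU1P[<-|xy].
    by rewrite !subrr !mulr0 !subr0 addr0.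
  have yx0 : 0 < y - x by rewrite subr_gt0.
  have := dv (y - x); rewrite /= sub0r normrN distrC => /(_ xyr).
  rewrite gt_eqF// => /(_ isT); rewrite subrK distrC => /(le_trans (ler_norm _)).
  rewrite lerBlDr => h.
  have : f y - f x <= e1 * (y - x).
    rewrite -ler_pdivrMr// mulrC; apply: le_trans h _; lra.
  by lra.
have Ga : G a = 0.
  rewrite /G /m max_r// /clip_length set_itv_ge ?setI0 ?measure0//.
  by rewrite bnd_simp ltxx.
have Gbb : G b <= e2 by rewrite /G /m max_r.
move: HbHa; rewrite /H Ga subrr !mulr0 !subr0.
have : e1 * (b - a) <= e / 2.
  rewrite /e1 -mulrA ler_piMr ?divr_ge0 ?(ltW e0)//.
  by rewrite mulrC ler_pdivrMr ?mul1r ?lerDl// ltr_wpDl.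
have : C * G b <= e / 2.
  apply: (@le_trans _ _ (C * e2)); first by rewrite ler_wpM2l.
  rewrite /e2 mulrCA ler_piMr ?divr_ge0 ?(ltW e0)//.
  by rewrite ler_pdivrMr ?mul1r ?lerDl// ltr_wpDl.
by lra.
Qed.

(** * Almost everywhere derivability of Lipschitz functions *)

Lemma stieltjes_measure_itv (R : realType) (g : cumulative R R) (u v : R) : u <= v ->
  lebesgue_stieltjes_measure g `]u, v]%classic = (g v - g u)%:E.
Proof.
move=> uv; rewrite /lebesgue_stieltjes_measure /measure_extension.
by rewrite measurable_mu_extE/=; [rewrite wlength_itv_bnd|exact: is_ocitv].
Qed.

(** The functions [id / 2 + f] and [id / 2 - f] are nondecreasing and add up to
    the identity, so the sum of their Stieltjes measures is the Lebesgue measure.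
    Hence the first one is absolutely continuous, and by Radon-Nikodym
    [id / 2 + f] is the primitive of an integrable function, which the Lebesgue
    differentiation theorem differentiates. *)
Lemma half_lipschitz_ae_derivable (R : realType) (f : R -> R) (N : nat) :
  (forall x y, `|f x - f y| <= 2^-1 * `|x - y|) ->
  {ae lebesgue_measure, forall t, 0 < t < N%:R -> derivable f t 1}.
Proof.
move=> lipf.
have cf := lipschitz_continuous lipf.
pose g0 s x : R := 2^-1 * x + s * f x.
have cg0 s : continuous (g0 s).
  by move=> x; apply: cvgD; apply: cvgMr; [exact: cvg_id|exact: cf].
have nd0 s : `|s| = 1 -> {homo (g0 s) : x y / x <= y}.
  move=> s1 x y xy; rewrite -subr_ge0.
  have -> : g0 s y - g0 s x = 2^-1 * (y - x) - s * (f x - f y) by rewrite /g0; ring.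
  rewrite subr_ge0 (le_trans (ler_norm _))// normrM s1 mul1r (le_trans (lipf _ _))//.
  by rewrite distrC ger0_norm ?subr_ge0.
have [n1 n2] : `|1 : R| = 1 /\ `|-1 : R| = 1 by rewrite normrN normr1.
pose g1 : cumulative R R :=
  HB.pack (g0 1)
    (isCumulative.Build R _ R (g0 1) (nd0 _ n1) (right_continuousW (cg0 _))).
pose g2 : cumulative R R :=
  HB.pack (g0 (-1))
    (isCumulative.Build R _ R (g0 (-1)) (nd0 _ n2) (right_continuousW (cg0 _))).
have mg1 := stieltjes_measure_itv g1; have mg2 := stieltjes_measure_itv g2.
have sumE A : measurable A -> lebesgue_measure A =
    (lebesgue_stieltjes_measure g1 A + lebesgue_stieltjes_measure g2 A)%E.
  move=> mA.
  transitivity (measure_add (lebesgue_stieltjes_measure g1)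
      (lebesgue_stieltjes_measure g2) A); last by rewrite measure_addE.
  apply: lebesgue_measure_unique => // X /ocitvP[->|[[u v]/= uv ->]].
    by rewrite !measure0.
  rewrite [RHS]measure_addE [X in _ = (X + _)%E](mg1 _ _ (ltW uv)).
  rewrite [X in _ = (_ + X)%E](mg2 _ _ (ltW uv)) lebesgue_measure_itv/= lte_fin uv -!EFinD.
  by congr EFin; rewrite /g0; lra.
have [N0|N0] := leqP N 0.
  apply: aeW => t; move: N0; rewrite leqn0 => /eqP -> /andP[t0].
  by rewrite ltNge (ltW t0).
have mI : measurable (`]0, N%:R]%classic : set (measurableTypeR R)).
  exact: measurable_itv.
have fI : (lebesgue_stieltjes_measure g1 (`]0%R, N%:R%R]%classic : set R) < +oo)%E.
  by rewrite mg1 ?ltry.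
pose nu : {finite_measure set (measurableTypeR R) -> \bar R} := mfrestr mI fI.
have nulam : nu `<< (@lebesgue_measure R).
  apply/null_content_dominatesP => A mA A0.
  apply/eqP; rewrite eq_le measure_ge0 andbT.
  apply: (@le_trans _ _ (lebesgue_stieltjes_measure g1 A)).
    by apply: le_measure; rewrite ?inE//; exact: measurableI.
  by rewrite -A0 [leRHS](sumE _ mA) leeDl.
have [h [h0 hfin hint nuE]] := radon_nikodym_sigma_finite nulam.
have hE : EFin \o (fine \o h) = h by apply/funext => x /=; rewrite fineK.
have intF (D : set (measurableTypeR R)) : measurable D ->
    lebesgue_measure.-integrable D (EFin \o (fine \o h)).
  by move=> mD; rewrite hE; apply: integrableS hint.
have loc : locally_integrable [set: R] (fine \o h).
  split.
  - by have /measurable_int/measurable_EFinP := intF setT measurableT.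
  - exact: openT.
  - move=> L _ cL; have mL := compact_measurable cL.
    by have /integrableP[] := intF _ mL.
have := @FTC1 R (fine \o h) (BRight 0) (fun y => intF _ (measurable_itv _)) loc.
apply: (@filterS _ _ (ae_filter_ringOfSetsType (@lebesgue_measure R))) => t der /andP[t0 tN].
have {der} [der _] := der t0.
set F := (F in derivable F t 1) in der.
apply: (@near_eq_derivable _ _ _ (fun y => F y + g0 1 0 - 2^-1 * y)).
  near=> y.
  have y0 : 0 < y by near: y; exact: lt_nbhsr.
  have yN : y < N%:R by near: y; exact: lt_nbhsl.
  have -> : F y = g0 1 y - g0 1 0.
    have m0y : measurable (`]0, y]%classic : set (measurableTypeR R)).
      exact: measurable_itv.
    rewrite /F /Rintegral (eq_integral h); last by move=> z _ /=; rewrite fineK.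
    rewrite -nuE// /nu/= /mfrestr /mrestr setIidl.
      by rewrite mg1 ?(ltW y0).
    by move=> z; rewrite /= !in_itv/= => /andP[-> /le_trans]; apply; exact: ltW.
  by rewrite /g0; ring.
apply: derivableB; first exact: (derivableD der (derivable_cst _ _ _)).
by apply: derivableM.
Unshelve. all: by end_near. Qed.

Lemma lipschitz_ae_derivable (R : realType) (f : R -> R) (C : R) :
  (forall x y, `|f x - f y| <= C * `|x - y|) ->
  {ae lebesgue_measure, forall t, 0 < t -> derivable f t 1}.
Proof.
move=> lipf.
pose c := (2 * (`|C| + 1))^-1.
have C0 : 0 < 2 * (`|C| + 1) by rewrite mulr_gt0// ltr_wpDl.
have c0 : 0 < c by rewrite invr_gt0.
have lipcf x y : `|(c *: f) x - (c *: f) y| <= 2^-1 * `|x - y|.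
  rewrite /= -scalerBr normrZ gtr0_norm//.
  apply: (@le_trans _ _ (c * (`|C| + 1) * `|x - y|)).
    rewrite -mulrA ler_pM2l//; apply: le_trans (lipf _ _) _.
    by rewrite ler_wpM2r// (le_trans (ler_norm C))// lerDl.
  suff -> : c * (`|C| + 1) = 2^-1 by [].
  by rewrite /c invfM -mulrA mulVf ?mulr1// gt_eqF// ltr_wpDl.
have : {ae lebesgue_measure, forall (t : R) (N : nat), 0 < t < N%:R -> derivable (c *: f) t 1}.
  apply/ae_foralln => N; exact: half_lipschitz_ae_derivable.
apply: (@filterS _ _ (ae_filter_ringOfSetsType (@lebesgue_measure R))) => t der t0.
have -> : f = c^-1 *: (c *: f) by rewrite scalerA mulVf ?scale1r// gt_eqF.
apply: derivableZ; apply: (der (Num.truncn t).+1).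
by rewrite t0 truncnS_gt.
Qed.

(** * The Euclidean norm *)

Section euclidean.
Context (R : realType) (d : nat).
Implicit Types u v w : 'rV[R]_d.

Definition dot u v : R := \sum_(i < d) u ord0 i * v ord0 i.

Lemma enorm_ge0 v : 0 <= enorm v.
Proof. exact: sqrtr_ge0. Qed.

Lemma enorm_sqr v : enorm v ^+ 2 = dot v v.
Proof. by rewrite sqr_sqrtr//; apply: sumr_ge0 => i _; exact: sqr_ge0. Qed.

Lemma enorm0 : enorm (0 : 'rV[R]_d) = 0.
Proof.
by rewrite /enorm big1 ?sqrtr0// => i _; rewrite mxE expr0n.
Qed.

Lemma enormZ (a : R) v : enorm (a *: v) = `|a| * enorm v.
Proof.
rewrite /enorm -sqrtr_sqr -sqrtrM ?sqr_ge0// mulr_sumr; congr Num.sqrt.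
by apply: eq_bigr => i _; rewrite mxE exprMn.
Qed.

Lemma enormN v : enorm (- v) = enorm v.
Proof. by rewrite -scaleN1r enormZ normrN normr1 mul1r. Qed.

Lemma enormB u v : enorm (u - v) = enorm (v - u).
Proof. by rewrite -enormN opprB. Qed.

Lemma coord_le_enorm v i : `|v ord0 i| <= enorm v.
Proof.
rewrite -sqrtr_sqr ler_wsqrtr// (bigD1 i)//= lerDl.
by apply: sumr_ge0 => j _; exact: sqr_ge0.
Qed.

Lemma enorm_eq0 v : enorm v = 0 -> v = 0.
Proof.
move=> v0; apply/rowP => i; apply/eqP; rewrite mxE -normr_le0 -v0.
exact: coord_le_enorm.
Qed.

Lemma dot_le_enorm u v : dot u v <= enorm u * enorm v.
Proof.
have [u0|u0] := eqVneq (enorm u) 0.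
  rewrite u0 mul0r /dot big1// => i _.
  by rewrite (enorm_eq0 u0) mxE mul0r.
have [v0|v0] := eqVneq (enorm v) 0.
  rewrite v0 mulr0 /dot big1// => i _.
  by rewrite (enorm_eq0 v0) mxE mulr0.
have uv0 : 0 < enorm u * enorm v.
  by rewrite mulr_gt0// lt0r enorm_ge0 ?u0 ?v0.
have : 2 * (enorm u * enorm v) * dot u v <=
    2 * (enorm u * enorm v) * (enorm u * enorm v).
  have -> : 2 * (enorm u * enorm v) * (enorm u * enorm v) =
      enorm v ^+ 2 * dot u u + enorm u ^+ 2 * dot v v.
    by rewrite -!enorm_sqr; ring.
  rewrite /dot !mulr_sumr -big_split/=; apply: ler_sum => i _.
  have := sqr_ge0 (enorm v * u ord0 i - enorm u * v ord0 i); nra.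
by rewrite ler_pM2l// mulr_gt0.
Qed.

Lemma ler_enormD u v : enorm (u + v) <= enorm u + enorm v.
Proof.
rewrite -(ler_pXn2r (n := 2)) ?nnegrE ?addr_ge0 ?enorm_ge0//.
have -> : enorm (u + v) ^+ 2 = dot u u + 2 * dot u v + dot v v.
  rewrite enorm_sqr /dot mulr_sumr -!big_split/=; apply: eq_bigr => i _.
  by rewrite !mxE; ring.
rewrite -!enorm_sqr sqrrD -mulr_natl; have := dot_le_enorm u v; lra.
Qed.

Lemma ler_enormB u v w : enorm (u - v) <= enorm (u - w) + enorm (w - v).
Proof. by rewrite -(subrKA w) ler_enormD. Qed.

Lemma normr_le_enorm v : `|v| <= enorm v.
Proof.
rewrite /Num.Def.normr/= mx_normrE bigmax_le ?enorm_ge0// => -[i j] _ /=.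
by rewrite (ord1 i) coord_le_enorm.
Qed.

Lemma coord_le_normr v i : `|v ord0 i| <= `|v|.
Proof.
rewrite {2}/Num.Def.normr/= mx_normrE.
exact: (le_bigmax _ (fun ij => `|v ij.1 ij.2|) (ord0, i)).
Qed.

Lemma normr_row_lt v (e : R) : 0 < e -> (forall i, `|v ord0 i| < e) -> `|v| < e.
Proof.
move=> e0 ve; rewrite /Num.Def.normr/= mx_normrE (bigmax_lt _ e0)// => -[i0 i] _.
by rewrite (ord1 i0) ve.
Qed.

Lemma enorm_le_normr v : enorm v <= d%:R * `|v|.
Proof.
rewrite -[leRHS]ger0_norm ?mulr_ge0// -sqrtr_sqr ler_wsqrtr//.
apply: (@le_trans _ _ (\sum_(i < d) `|v| ^+ 2)).
  apply: ler_sum => i _; rewrite -[leLHS]real_normK ?num_real//.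
  by rewrite lerXn2r ?nnegrE// coord_le_normr.
rewrite sumr_const card_ord exprMn -[leLHS]mulr_natl ler_wpM2r ?sqr_ge0//.
case: d => [|n]; first by rewrite expr0n.
by rewrite expr2 ler_peMl// ler1n.
Qed.

Lemma enorm_dist u v : `|enorm u - enorm v| <= enorm (u - v).
Proof.
rewrite ler_norml.
have := ler_enormD (u - v) v; have := ler_enormD (v - u) u.
by rewrite !subrK (enormB v); lra.
Qed.

Lemma enorm_continuous : continuous (@enorm R d).
Proof.
move=> u; apply/(cvgrPdist_le (FF := nbhs_filter u)) => /= e e0.
apply/nbhs_ballP.
have d1 : (0 : R) < d%:R + 1 by rewrite ltr_wpDl.
exists (e / (d%:R + 1)); first by rewrite /= divr_gt0.
move=> v; rewrite -ball_normE /= => uv.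
rewrite (le_trans (enorm_dist _ _))// (le_trans (enorm_le_normr _))//.
apply: (@le_trans _ _ ((d%:R + 1) * `|u - v|)).
  by rewrite ler_wpM2r// lerDl.
by rewrite mulrC -ler_pdivlMr// ltW.
Qed.

Lemma is_derive_coord (G : R -> 'rV[R]_d) (t : R) w i :
  is_derive t 1 G w -> is_derive t 1 (fun x => G x ord0 i) (w ord0 i).
Proof.
move=> [der <-]; have /derivable_mxP/(_ ord0 i) deri := der.
by apply: DeriveDef => //; rewrite derive_mx// mxE.
Qed.

Lemma is_derive_row (G : R -> 'rV[R]_d) (t : R) w :
  (forall i, is_derive t 1 (fun x => G x ord0 i) (w ord0 i)) ->
  is_derive t 1 G w.
Proof.
move=> deri; have der : derivable G t 1.
  by apply/derivable_mxP => i j; rewrite (ord1 i); have [] := deri j.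
apply: DeriveDef => //; rewrite derive_mx//; apply/rowP => j.
by rewrite mxE; have [_ ->] := deri j.
Qed.

Lemma is_derive_dot (G : R -> 'rV[R]_d) (t : R) w v :
  is_derive t 1 G w -> is_derive t 1 (fun x => dot v (G x)) (dot v w).
Proof.
move=> der.
rewrite /dot.
rewrite (_ : (fun x => _) = \sum_(i < d) (fun x => v ord0 i * G x ord0 i)).
  apply: is_derive_sum => i.
  by have := is_derive_coord i der => deri; exact: is_deriveZ.
by apply/funext => x; rewrite fct_sumE.
Qed.

End euclidean.

Lemma rat_row_approx (R : realType) (d : nat) (v : 'rV[R]_d) (e : R) : 0 < e ->
  exists q : 'rV[rat]_d, `|v - map_mx ratr q| < e.
Proof.
move=> e0.
have ex i : exists q : rat, `|v ord0 i - ratr q| < e.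
  have lt : v ord0 i - e < v ord0 i + e by lra.
  have [q /[!in_itv]/= /andP[h1 h2]] := rat_in_itvoo lt.
  by exists q; rewrite ltr_norml; lra.
have [q vq] := choice ex.
by exists (\row_i q i); apply: normr_row_lt => // i; rewrite !mxE.
Qed.

(** An open set is the union of the countably many rational boxes it contains. *)
Lemma measurable_row (R : realType) (d : nat) dT (T : measurableType dT)
    (D : set T) (u : T -> borel 'rV[R]_d) :
  (forall i, measurable_fun D (fun x => (u x : 'rV[R]_d) ord0 i)) ->
  measurable_fun D u.
Proof.
move=> mu mD; move: (mD).
apply: (@measurability _ _ _ (borel 'rV[R]_d) D u (@open 'rV[R]_d)) => //.
move=> _ [U oU <-] /=.
pose box (c : 'rV[rat]_d * nat) : set (borel 'rV[R]_d) :=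
  [set v : 'rV[R]_d | `|v - map_mx ratr c.1| < c.2.+1%:R^-1].
have -> : D `&` u @^-1` U =
    \bigcup_(c in [set c | box c `<=` U]) (D `&` u @^-1` box c).
  apply/seteqP; split => [x [Dx Ux]|x [c cU [Dx bx]]]; last first.
    by split => //; exact: cU.
  have /nbhs_ballP[e /= e0 sub] : nbhs (u x : 'rV[R]_d) U.
    exact: (open_nbhs_nbhs (conj oU Ux)).
  have [n ne] : exists n : nat, n.+1%:R^-1 < e / 2.
    exists (Num.truncn (e / 2)^-1); rewrite invf_plt ?posrE ?divr_gt0//.
    exact: truncnS_gt.
  have n0 : (0 : R) < n.+1%:R^-1 by rewrite invr_gt0.
  have [q uq] := rat_row_approx (u x) n0.
  exists (q, n) => // v bv; apply: sub; rewrite -ball_normE /=.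
  rewrite -(subrKA (map_mx ratr q)) (le_lt_trans (ler_normD _ _))//.
  rewrite [X in _ + X]distrC [ltRHS](splitr e) ltrD//; first exact: lt_trans ne.
  exact: lt_trans ne.
rewrite bigcup_mkcond; apply: countable_bigcupT_measurable => // c.
case: ifP => // _.
pose Bi i : set T := D `&` (fun x => (u x : 'rV[R]_d) ord0 i) @^-1`
  ball (ratr (c.1 ord0 i) : R) c.2.+1%:R^-1.
have -> : D `&` u @^-1` box c = D `&` \bigcap_(i in [set: 'I_d]) Bi i.
  apply/seteqP; split => x [Dx bx]; split => //.
    move=> i _; split => //; rewrite /ball/= distrC; apply: le_lt_trans bx.
    by have := coord_le_normr ((u x : 'rV[R]_d) - map_mx ratr c.1) i; rewrite !mxE.
  apply: normr_row_lt => [|i]; first by rewrite invr_gt0.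
  by have [//|_] := bx i; rewrite /ball/= distrC !mxE.
apply: measurableI => //; apply: fin_bigcap_measurable => // i _.
by apply: (mu i) => //; exact: measurable_ball.
Qed.

(** * The half-line and curves in the closure of the domain *)

Section half_line.
Context (R : realType).

Lemma rplus_val_ge0 (t : Rplus R) : 0 <= rplus_val t.
Proof. by have := set_valP t; rewrite /= in_itv/= andbT. Qed.

Lemma rplusK (t : R) : 0 <= t -> rplus_val (rplus t) = t.
Proof. by move=> t0; rewrite /rplus_val/= max_r. Qed.

Lemma rplus_valE (t : R) : rplus_val (rplus t) = Num.max 0 t.
Proof. by []. Qed.

Lemma rplus_valK : cancel (@rplus_val R) (@rplus R).
Proof. by move=> t; apply: val_inj; rewrite /= max_r// rplus_val_ge0. Qed.

Lemma rplus_val_lipschitz (s t : R) :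
  `|rplus_val (rplus s) - rplus_val (rplus t)| <= `|s - t|.
Proof. exact: max_contract. Qed.

Lemma continuous_rplus_val : continuous (@rplus_val R).
Proof. exact: initial_continuous. Qed.

Lemma continuous_rplus : continuous (@rplus R).
Proof.
apply: continuous_comp_initial.
apply: (@lipschitz_continuous _ _ 1) => x y; rewrite mul1r.
exact: rplus_val_lipschitz.
Qed.

End half_line.

Section curves.
Context (R : realType) (d : nat) (Omega : set 'rV[R]_d).
Variable Omega0 : Omega !=set0.
Implicit Types (g : curve Omega0).

Lemma continuous_cldom_val : continuous (@cldom_val R d Omega Omega0).
Proof. exact: initial_continuous. Qed.

Lemma cldom_valP (x : cldom Omega0) : closure Omega (cldom_val x).
Proof. exact: set_valP. Qed.

Lemma cldom_val_inj : injective (@cldom_val R d Omega Omega0).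
Proof. exact: val_inj. Qed.

Definition to_cldom (v : 'rV[R]_d) : cldom Omega0 :=
  match pselect (closure Omega v) with
  | left h => exist (fun z : 'rV[R]_d => z \in closure Omega) v (mem_set h)
  | right _ => cldom_point Omega0
  end.

Lemma to_cldomK v : closure Omega v -> cldom_val (to_cldom v) = v.
Proof. by rewrite /to_cldom; case: pselect. Qed.

Lemma in_space_rplus g (t : Rplus R) : in_space g (rplus_val t) = cldom_val (g t).
Proof. by rewrite /in_space rplus_valK. Qed.

Lemma continuous_in_space g : continuous g -> continuous (in_space g).
Proof.
move=> cg t; apply: continuous_comp; last exact: continuous_cldom_val.
by apply: continuous_comp; [exact: continuous_rplus|exact: cg].
Qed.

Lemma lipschitz_in_space g (M : R) :
  (forall s t : Rplus R, enorm (cldom_val (g s) - cldom_val (g t)) <=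
    M * `|rplus_val s - rplus_val t|) ->
  forall s t, enorm (in_space g s - in_space g t) <= `|M| * `|s - t|.
Proof.
move=> lipg s t; rewrite (le_trans (lipg _ _))//.
apply: (@le_trans _ _ (`|M| * `|rplus_val (rplus s) - rplus_val (rplus t)|)).
  by rewrite ler_wpM2r// ler_norm.
by rewrite ler_wpM2l// rplus_val_lipschitz.
Qed.

Lemma lipschitz_curve_continuous g : lipschitz_curve g -> continuous g.
Proof.
move=> [M lipg].
have cc : continuous (fun t => cldom_val (g t)).
  move=> t; apply/(cvgrPdist_le (FF := nbhs_filter t)) => /= e e0.
  have M1 : 0 < `|M| + 1 by rewrite ltr_wpDl.
  have eM : 0 < e / (`|M| + 1) by rewrite divr_gt0.
  have := proj1 (cvgrPdist_lt (FF := nbhs_filter t) (@rplus_val R) (rplus_val t))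
    (@continuous_rplus_val R t) _ eM.
  apply: filterS => s st.
  rewrite (le_trans (normr_le_enorm _))// (le_trans (lipg _ _))//.
  apply: (@le_trans _ _ ((`|M| + 1) * `|rplus_val t - rplus_val s|)).
    by rewrite ler_wpM2r// (le_trans (ler_norm M))// lerDl.
  by rewrite mulrC -ler_pdivlMr// ltW.
exact: (continuous_comp_initial cc).
Qed.

(** The integral-free form of the bound of the increments of [g] by the integral
    of [k] along [g]. It passes to locally uniform limits. *)
Definition speed_bounded (k : Rplus R -> cldom Omega0 -> R) g :=
  forall s t M : R, 0 <= s -> s <= t ->
    (forall r, s <= r <= t -> k (rplus r) (g (rplus r)) <= M) ->
    enorm (in_space g t - in_space g s) <= M * (t - s).

(** Along the direction [v] of the increment, the derivative of [dot v g] is at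
    most [enorm v * M] almost everywhere. *)
Lemma Adm_speed_bounded (k : Rplus R -> cldom Omega0 -> R) g :
  (forall t x, 0 <= k t x) -> Adm k g -> speed_bounded k g.
Proof.
move=> k0 [[C lipg] [u [mu u1 der]]] s t M s0 st kM.
pose v := in_space g t - in_space g s.
pose phi x := dot v (in_space g x) - enorm v * M * x.
have M0 : 0 <= M by rewrite (le_trans (k0 _ _) (kM s _))// lexx.
have dotB (a b c : 'rV[R]_d) : dot a b - dot a c = dot a (b - c).
  by rewrite /dot -sumrB; apply: eq_bigr => i _; rewrite !mxE mulrBr.
have absdot (a b : 'rV[R]_d) : `|dot a b| <= enorm a * enorm b.
  rewrite ler_norml dot_le_enorm andbT lerNl.
  have := dot_le_enorm a (- b); rewrite enormN.
  suff -> : dot a (- b) = - dot a b by [].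
  by rewrite /dot -sumrN; apply: eq_bigr => i _; rewrite mxE mulrN.
have lipphi x y : `|phi x - phi y| <= (enorm v * `|C| + enorm v * M) * `|x - y|.
  have -> : phi x - phi y = dot v (in_space g x - in_space g y) - enorm v * M * (x - y).
    by rewrite -dotB /phi; ring.
  rewrite (le_trans (ler_normB _ _))// mulrDl lerD//.
    rewrite (le_trans (absdot _ _))// -mulrA ler_wpM2l ?enorm_ge0//.
    exact: lipschitz_in_space.
  by rewrite normrM ger0_norm// mulr_ge0// enorm_ge0.
have : phi t <= phi s.
  apply: (lipschitz_ae_nonincreasing _ st lipphi).
    by rewrite addr_ge0// mulr_ge0// enorm_ge0.
  apply: (@filterS _ _ (ae_filter_ringOfSetsType (@lebesgue_measure R))) der.
  move=> r der /andP[sr rt].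
  have r0 := le_trans s0 sr.
  have dphi := is_derive_dot v (der r0).
  exists (dot v (k (rplus r) (g (rplus r)) *: (u r : 'rV[R]_d)) - enorm v * M).
    have -> : phi = (fun x => dot v (in_space g x)) - (enorm v * M) *: (@idfun R).
      by apply/funext => x; rewrite /phi !fctE.
    apply: is_deriveB.
    have := @is_deriveZ _ _ _ (@idfun R) (enorm v * M) r 1 1 (is_derive_id _ _).
    by rewrite [_ *: 1]mulr1.
  rewrite subr_le0 (le_trans (dot_le_enorm _ _))// ler_wpM2l ?enorm_ge0//.
  rewrite enormZ ger0_norm ?k0// (le_trans _ (kM r _))//; last by rewrite sr ltW.
  by rewrite ler_piMr// u1.
rewrite /phi => h.
have {h} : dot v v <= enorm v * (M * (t - s)).
  have dvv : dot v (in_space g t) - dot v (in_space g s) = dot v v by exact: dotB.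
  by lra.
rewrite -enorm_sqr expr2.
have [v0|v0] := eqVneq (enorm v) 0.
  by rewrite v0 => _; rewrite mulr_ge0// subr_ge0.
by rewrite ler_pM2l// lt0r v0 enorm_ge0.
Qed.

End curves.

(** * Curves of bounded speed are admissible *)

Section speed_bounded_adm.
Context (R : realType) (d : nat) (Omega : set 'rV[R]_d).
Variable Omega0 : Omega !=set0.
Implicit Types (g : curve Omega0) (k : Rplus R -> cldom Omega0 -> R).

Lemma speed_bounded_lipschitz k g (M : R) : 0 <= M ->
  (forall t x, k t x <= M) -> speed_bounded k g ->
  forall s t : R, enorm (in_space g s - in_space g t) <= M * `|s - t|.
Proof.
move=> M0 kM sg s t.
suff main (a b : R) : a <= b ->
    enorm (in_space g b - in_space g a) <= M * `|b - a|.
  have [st|/ltW ts] := leP s t; last exact: main.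
  by rewrite enormB distrC main.
move=> {s t} ab.
have E (x : R) : in_space g x = in_space g (Num.max 0 x).
  by rewrite /in_space -[RHS]/(cldom_val (g (rplus (rplus_val (rplus x))))) rplus_valK.
rewrite [in_space g a]E [in_space g b]E.
apply: le_trans (ler_wpM2l M0 (rplus_val_lipschitz b a)).
rewrite !rplus_valE.
have h : Num.max 0 a <= Num.max 0 b by rewrite ge_max !le_max lexx ab/= orbT.
rewrite ger0_norm ?subr_ge0//.
by apply: sg => //; rewrite le_max lexx.
Qed.

Lemma derive_speed_bounded k g (t : R) (w : 'rV[R]_d) :
  speed_bounded k g -> 0 < t ->
  {for t, continuous (fun t => k (rplus t) (g (rplus t)))} ->
  is_derive t 1 (in_space g) w ->
  enorm w <= k (rplus t) (g (rplus t)).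
Proof.
move=> sg t0 ck der; apply/ler_addgt0Pr => e e0.
set M := _ + e.
have [r r0 kr] : exists2 r : R, 0 < r & forall h, `|h| < r ->
    k (rplus (t + h)) (g (rplus (t + h))) <= M.
  have /cvgrPdist_le/(_ _ e0)[r /= r0 kr] := ck.
  exists r => // h hr; have := kr (t + h).
  rewrite /= opprD addrA subrr sub0r normrN => /(_ hr); rewrite distrC => h1.
  by have := le_trans (ler_norm _) h1; rewrite lerBlDl.
have dvn := cvg_comp _ _ (cvg_quotient der) (@enorm_continuous R d w).
apply: (cvgr_to_le dvn).
exists (Num.min r t); first by rewrite /= lt_min r0.
move=> h /=; rewrite sub0r normrN lt_min => /andP[hr ht] h0.
rewrite enormZ normfV mulrC ler_pdivrMr ?normr_gt0//.
have [h1|h1] := leP 0 h.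
  rewrite ger0_norm//.
  have := sg t (h + t) M; rewrite addrK; apply; rewrite ?lerDr ?(ltW t0)// => u /andP[tu uh].
  have -> : u = t + (u - t) by ring.
  apply: kr; rewrite (le_lt_trans _ hr)// !ger0_norm ?subr_ge0//; lra.
rewrite ltr0_norm// enormB; have <- : t - (h + t) = - h by ring.
have h2 : 0 <= h + t by move: ht; rewrite ltr0_norm//; lra.
apply: sg => //; first by lra.
move=> u /andP[tu uh].
have -> : u = t + (u - t) by ring.
apply: kr; rewrite (le_lt_trans _ hr)// !ler0_norm ?subr_le0//; lra.
Qed.

(** The control is the derivative of [g], computed as the limit of its difference
    quotients, divided by [k]. The upper limit [D] of these quotients is a
    measurable function defined at all times; the control is set to 0 where [D]
    is too large, which excludes no time at which [g] is derivable. *)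
Lemma speed_bounded_Adm k g (kmin kmax : R) : 0 < kmin ->
  (forall t x, kmin <= k t x <= kmax) ->
  (continuous g -> continuous (fun t : R => k (rplus t) (g (rplus t)))) ->
  speed_bounded k g -> Adm k g.
Proof.
move=> kmin0 kb ck sg.
have kmax0 : 0 <= kmax.
  have /andP[h1 h2] := kb (rplus 0) (g (rplus 0)).
  by rewrite (le_trans (ltW kmin0))// (le_trans h1 h2).
have kM t x : k t x <= kmax by have /andP[] := kb t x.
have km t x : kmin <= k t x by have /andP[] := kb t x.
have lip := speed_bounded_lipschitz kmax0 kM sg.
have lipg : lipschitz_curve g.
  exists kmax => s t; have := lip (rplus_val s) (rplus_val t).
  by rewrite !in_space_rplus.
have {}ck := ck (lipschitz_curve_continuous lipg).
split => //.
pose c t : R := k (rplus t) (g (rplus t)).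
pose G i t : R := in_space g t ord0 i.
have lipG i x y : `|G i x - G i y| <= kmax * `|x - y|.
  rewrite /G (le_trans _ (lip x y))//.
  by have := coord_le_enorm (in_space g x - in_space g y) i; rewrite !mxE.
pose q i (n : nat) t := n.+1%:R * (G i (t + n.+1%:R^-1) - G i t).
have qb i n t : `|q i n t| <= kmax.
  rewrite /q normrM ger0_norm// -ler_pdivlMl// mulrC (le_trans (lipG _ _ _))//.
  by rewrite addrAC subrr add0r ger0_norm.
pose D i t := limn_sup (q i ^~ t).
have mD i : measurable_fun setT (D i).
  apply: measurable_fun_limn_sup.
  - move=> t _; exists kmax => _ [n _ <-].
    exact: le_trans (ler_norm _) (qb _ _ _).
  - move=> t _; exists (- kmax) => _ [n _ <-].
    by have := qb i n t; rewrite ler_norml => /andP[].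
  move=> n; apply: continuous_measurable_fun => x.
  have cG := lipschitz_continuous (lipG i).
  apply: cvgMr; apply: cvgB; last exact: cG.
  apply: continuous_comp; last exact: cG.
  by apply: cvgD; [exact: cvg_id|exact: cvg_cst].
have DE i t : derivable (G i) t 1 -> 'D_1 (G i) t = D i t.
  move=> der.
  have dv := cvg_quotient (derivableP der).
  have : q i ^~ t @ \oo --> 'D_1 (G i) t.
    have cvn : (n.+1%:R^-1 : R) @[n --> \oo] --> 0^'.
      move=> A [e /= e0 eA].
      suff : \forall n \near \oo, A (n.+1%:R^-1) by [].
      near=> n.
      have n0 : (n.+1%:R^-1 : R) != 0 by rewrite invr_eq0 pnatr_eq0.
      apply: eA => //=; rewrite sub0r normrN ger0_norm//; near: n.
      exact: (near_infty_natSinv_lt (PosNum e0)).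
    have := cvg_comp _ _ cvn dv; apply: cvg_trans; apply: near_eq_cvg.
    apply: nearW => n; rewrite /=.
    by rewrite invrK /q (addrC t).
  by move=> /cvg_sups/cvg_lim <-.
pose w t : 'rV[R]_d := \row_i D i t.
exists (fun t => if enorm (w t) <= c t then (c t)^-1 *: w t else 0).
have ct t : 0 < c t by exact: lt_le_trans (km _ _).
split.
- apply: measurable_row => i; apply: measurable_funTS.
  rewrite (_ : (fun x => _) =
      (fun t => if enorm (w t) <= c t then (c t)^-1 * D i t else 0)); last first.
    by apply/funext => t; case: ifP => _; rewrite !mxE.
  have mc : measurable_fun setT c by exact: continuous_measurable_fun.
  apply: measurable_fun_ifT => //.
    apply: measurable_fun_ler => //.
    rewrite -[X in measurable_fun _ X]/(Num.sqrt \o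
      (fun t => \sum_(i < d) w t ord0 i ^+ 2)).
    apply: measurableT_comp.
      exact: continuous_measurable_fun (@sqrt_continuous R).
    apply: measurable_sum => j.
    rewrite (_ : (fun x => _) = (fun t => D j t ^+ 2)); last by apply/funext => x; rewrite mxE.
    exact: measurable_funX.
  apply: measurable_funM => //.
  apply: continuous_measurable_fun => t; apply: cvgV; last exact: ck.
  by rewrite gt_eqF.
- move=> t t0; case: ifP => h; last by rewrite enorm0.
  by rewrite enormZ ger0_norm ?invr_ge0 ?(ltW (ct t))// mulrC ler_pdivrMr// mul1r.
have : {ae lebesgue_measure, forall t, forall i, 0 < t -> derivable (G i) t 1}.
  have Fae := ae_filter_ringOfSetsType (@lebesgue_measure R).
  apply: filter_forall => i.
  exact: lipschitz_ae_derivable (lipG i).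
have : {ae lebesgue_measure, forall t : R, t <> 0}.
  exists [set 0]; split => //; first exact: lebesgue_measure_set1.
  by move=> t /= /contrapT ->.
apply: (@filterS2 _ _ (ae_filter_ringOfSetsType (@lebesgue_measure R))) => t t0 der tge0.
have {t0} t0 : 0 < t by rewrite lt0r tge0 andbT; apply/eqP.
have dw : is_derive t 1 (in_space g) (w t).
  apply: is_derive_row => i; rewrite mxE.
  by apply: DeriveDef; [exact: der|rewrite DE//; exact: der].
have wc : enorm (w t) <= c t by apply: (derive_speed_bounded sg t0 _ dw); exact: ck.
rewrite wc scalerA -/(c t) mulfV ?gt_eqF// scale1r; exact: dw.
Unshelve. all: by end_near. Qed.

End speed_bounded_adm.

(** * Unit speed parametrization of rectifiable curves *)

Section unit_speed.
Context (R : realType) (d : nat).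
Implicit Types (c : R -> 'rV[R]_d).

Lemma curve_length_rcons c (a s t : R) : a <= s -> s <= t ->
  (curve_length a s c + (enorm (c t - c s))%:E <= curve_length a t c)%E.
Proof.
move=> as_; rewrite le_eqVlt => /predU1P[<-|st].
  by rewrite subrr enorm0 adde0.
rewrite -leeBrDr//; apply: ge_ereal_sup => _ [p [pp /eqP lp] <-].
rewrite leeBrDr// -EFinD; apply: ereal_sup_ubound.
exists (rcons p t).
  split; last by rewrite last_rcons.
  by rewrite rcons_path pp/= lp.
congr EFin; rewrite /= size_rcons big_nat_recr//=; congr (_ + enorm (c _ - c _)).
- rewrite !big_nat; apply: eq_bigr => n /= np; congr (enorm (c _ - c _)).
    by rewrite nth_rcons np; apply: set_nth_default.
  case: n np => [//|n] np /=; rewrite nth_rcons (ltnW np); apply: set_nth_default.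
  exact: ltnW.
- by rewrite nth_rcons ltnn eqxx.
- rewrite -[rcons p t]/(rcons p t) -rcons_cons nth_rcons/= ltnS leqnn.
  by rewrite nth_last/= lp.
Qed.

Lemma curve_length_refl c (a : R) : curve_length a a c = 0%E.
Proof.
rewrite /curve_length (_ : [set _ | _ in _] = [set 0%E]) ?ereal_sup1//.
apply/seteqP; split => [_ [p /itv_partitionxx -> <-]|_ ->] /=.
  by rewrite big_nil.
by exists [::]; [split => //=; rewrite eqxx|rewrite /= big_nil].
Qed.

(** At time [s], [c'] is at the last point of [c] reached by an arc of length at
    most [s]. This makes [c'] well defined also at the values of [s] that the
    length function misses or takes on a whole interval; there, continuity of [c]
    gives the estimate. *)
Lemma unit_speed_param c (l : R) : 0 <= l ->
  {within `[0, 1], continuous c} -> (curve_length 0 1 c <= l%:E)%E ->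
  exists c' : R -> 'rV[R]_d,
    [/\ c' 0 = c 0, c' l = c 1, (forall s, exists2 t, 0 <= t <= 1 & c' s = c t) &
      forall s t, 0 <= s -> s <= t -> enorm (c' t - c' s) <= t - s].
Proof.
move=> l0 cc cl.
have cw x e : 0 <= x <= 1 -> 0 < e -> exists2 r, 0 < r & forall y, 0 <= y <= 1 ->
    `|x - y| < r -> enorm (c x - c y) <= e.
  move=> x01 e0.
  have d1 : (0 : R) < d%:R + 1 by rewrite ltr_wpDl.
  have ed : 0 < e / (d%:R + 1) by rewrite divr_gt0.
  move/subspace_continuousP : cc => /(_ x).
  rewrite /= in_itv/= => /(_ x01).
  move/(proj1 (cvgrPdist_lt _ _)) => /(_ _ ed)[r /= r0 xr].
  exists r => // y y01 xy; have := xr y xy; rewrite /= in_itv/= => /(_ y01) h.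
  rewrite (le_trans (enorm_le_normr _))//.
  apply: (@le_trans _ _ ((d%:R + 1) * `|c x - c y|)).
    by rewrite ler_wpM2r// lerDl.
  by rewrite mulrC -ler_pdivlMr// ltW.
pose V t := curve_length 0 t c.
have Vinc s t : 0 <= s -> s <= t -> (V s + (enorm (c t - c s))%:E <= V t)%E.
  exact: curve_length_rcons.
have V0 : V 0 = 0%E by exact: curve_length_refl.
pose S s := [set t | 0 <= t <= 1 /\ (V t <= s%:E)%E].
have S0 s : 0 <= s -> S s 0 by move=> s0; split; rewrite ?lexx ?ler01// V0 lee_fin.
have S1 s : ubound (S s) 1 by move=> t [/andP[]].
have hS s : 0 <= s -> has_sup (S s).
  by move=> s0; split; [exists 0; exact: S0|exists 1].
pose p s := sup (S (Num.max 0 s)).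
have pE s : 0 <= s -> p s = sup (S s) by move=> s0; rewrite /p max_r.
have pS s t : 0 <= s -> S s t -> t <= p s.
  by move=> s0 Sst; rewrite pE// ub_le_sup//; exact: (proj2 (hS s s0)).
have p01 s : 0 <= p s <= 1.
  have m0 : 0 <= Num.max 0 s by rewrite le_max lexx.
  rewrite /p ub_le_sup/=; [|exact: (proj2 (hS _ m0))|exact: S0].
  exact: sup_le_ub (proj1 (hS _ m0)) (S1 _).
have left s e : 0 <= s -> 0 < e ->
    exists t, [/\ S s t, p s - e < t & enorm (c (p s) - c t) <= e].
  move=> s0 e0; have [r r0 cr] := cw (p s) e (p01 s) e0.
  have m0 : 0 < Num.min e r by rewrite lt_min e0.
  have [t St pt] := sup_adherent m0 (hS s s0); exists t.
  rewrite -pE// in pt; have tp := pS s t s0 St.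
  have [t1 t2] : p s - e < t /\ p s - r < t.
    by split; apply: le_lt_trans pt; rewrite lerD2l lerN2 ge_min lexx ?orbT.
  split => //; apply: cr; first by case: St.
  by rewrite ger0_norm ?subr_ge0// ltrBlDl -ltrBlDr.
exists (c \o p); split => /=.
- apply/eqP; rewrite -subr_eq0; apply/eqP/enorm_eq0/eqP.
  rewrite eq_le enorm_ge0 andbT; apply/ler_addgt0Pl => e e0; rewrite addr0.
  have [t [[/andP[t0 _] Vt] _ ct]] := left 0 e (lexx _) e0.
  have := le_trans (Vinc 0 t (lexx _) t0) Vt; rewrite V0 add0e lee_fin => ct0.
  by rewrite (le_trans (ler_enormB _ _ (c t)))//; lra.
- suff -> : p l = 1 by [].
  apply/eqP; rewrite eq_le; have /andP[_ ->] /= := p01 l.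
  by apply: pS => //; split => //; rewrite ler01 lexx.
- by move=> s; exists (p s).
move=> s t s0 st; have t0 := le_trans s0 st.
have ps_pt : p s <= p t.
  rewrite (pE s s0); apply: sup_le_ub; first exact: (proj1 (hS _ s0)).
  move=> u [u01 Vu]; apply: pS => //; split => //.
  by rewrite (le_trans Vu)// lee_fin.
move: ps_pt; rewrite le_eqVlt => /predU1P[->|pst].
  by rewrite subrr enorm0 subr_ge0.
apply/ler_addgt0Pr => e e0.
have e20 : 0 < e / 2 by rewrite divr_gt0.
have [r r0 cr] := cw (p s) (e / 2) (p01 s) e20.
(* An arc [[a, b]] inside [[p s, p t]], longer than [s] at [a] and not longer
   than [t] at [b], whose end points are close to those of [[p s, p t]]. *)
pose a := Num.min (p s + r / 2) ((p s + p t) / 2).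
have sa : p s < a by rewrite /a lt_min; apply/andP; split; lra.
have a1 : a <= p s + r / 2 by rewrite /a ge_min lexx.
have at_ : a < p t.
  by apply: (@le_lt_trans _ _ ((p s + p t) / 2)); [rewrite /a ge_min lexx orbT|lra].
have /andP[ps0 _] := p01 s; have /andP[_ pt1] := p01 t.
have ca : enorm (c (p s) - c a) <= e / 2.
  apply: cr; first by apply/andP; split; lra.
  by rewrite ltr0_norm; lra.
have Va : (s%:E < V a)%E.
  rewrite ltNge; apply/negP => Va; have : a <= p s.
    by apply: pS => //; split => //; apply/andP; split; lra.
  by rewrite leNgt sa.
have m0 : 0 < Num.min (e / 2) (p t - a) by rewrite lt_min divr_gt0//= subr_gt0.
have [b [[b01 Vb] pb cb]] := left t _ t0 m0.
have ab : a <= b.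
  have h : p t - (p t - a) <= p t - Num.min (e / 2) (p t - a).
    by rewrite lerD2l lerN2 ge_min lexx orbT.
  by rewrite (le_trans _ (ltW pb))// (le_trans _ h)//; lra.
have cbe : enorm (c (p t) - c b) <= e / 2.
  by rewrite (le_trans cb)// ge_min lexx.
have a0 : 0 <= a by lra.
have cab : enorm (c b - c a) <= t - s.
  have := le_trans (Vinc a b a0 ab) Vb.
  move/(le_trans (leeD2r _ (ltW Va))); rewrite -EFinD lee_fin; lra.
have := ler_enormB (c (p t)) (c (p s)) (c b).
have := ler_enormB (c b) (c (p s)) (c a).
rewrite (enormB (c a)); lra.
Qed.
End unit_speed.

(** * Following a curve with a delay *)

Section delayed_following.
Context (R : realType) (d : nat) (Omega : set 'rV[R]_d).
Variable Omega0 : Omega !=set0.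
Implicit Types (b g : curve Omega0).
Variables (k : Rplus R -> cldom Omega0 -> R) (kmin kmax L : R).
Hypothesis kmin0 : 0 < kmin.
Hypothesis kb : forall t x, kmin <= k t x <= kmax.
Hypothesis L0 : 0 < L.
Hypothesis kL : forall t x y,
  `|k t x - k t y| <= L * enorm (cldom_val x - cldom_val y).
Hypothesis kc : forall g, continuous g ->
  continuous (fun t : R => k (rplus t) (g (rplus t))).

Let kmax0 : 0 < kmax.
Proof.
have /andP[h1 h2] := kb (rplus 0) (cldom_point Omega0).
exact: lt_le_trans kmin0 (le_trans h1 h2).
Qed.

(** The distance from [b s] to [b t] minus [Phi t] is a locally nonincreasing
    function of [t], up to a small linear term. *)
Lemma speed_bounded_antiderivative b (Phi : R -> R) (s t : R) :
  speed_bounded k b -> continuous b ->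
  (forall t : R, 0 <= t -> is_derive t 1 Phi (k (rplus t) (b (rplus t)))) ->
  0 <= s -> s <= t ->
  enorm (in_space b t - in_space b s) <= Phi t - Phi s.
Proof.
move=> sb cb dPhi s0 st.
apply/ler_addgt0Pr => e0 e00.
pose e := e0 / (t - s + 1).
have ts0 : 0 < t - s + 1 by rewrite ltr_wpDl// subr_ge0.
have e_gt0 : 0 < e by rewrite divr_gt0.
have ets : e * (t - s) <= e0.
  rewrite /e -mulrA ler_piMr ?(ltW e00)// mulrC ler_pdivrMr ?mul1r//.
  by rewrite lerDl.
pose G := in_space b.
pose c (r : R) : R := k (rplus r) (b (rplus r)).
have cG : continuous G by exact: continuous_in_space.
have cc : continuous c by exact: kc.
(* [Phi] may be irregular at negative times, so that it is frozen before [s]. *)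
pose m x := Num.max s x.
have ms x : s <= m x by rewrite le_max lexx.
have cm : continuous m.
  by apply: (@lipschitz_continuous _ _ 1) => x y; rewrite mul1r max_contract.
have cPhi x : 0 <= x -> {for x, continuous Phi}.
  move=> x0; have [der _] := dPhi x x0.
  exact/differentiable_continuous/derivable1_diffP.
pose H x := enorm (G x - G s) - Phi (m x) - e * x.
suff : H t <= H s.
  by rewrite /H subrr enorm0 /m max_r// max_l//; lra.
apply: locally_nonincreasing => //.
  move=> x; apply: cvgB; first apply: cvgB.
  - apply: (@continuous_comp _ _ _ (fun x => G x - G s) (@enorm R d)).
      by apply: cvgB; [exact: cG|exact: cvg_cst].
    exact: enorm_continuous.
  - apply: continuous_comp; first exact: cm.
    exact/cPhi/(le_trans s0).
  - by apply: cvgMr; exact: cvg_id.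
move=> x /andP[sx xt]; have x0 := le_trans s0 sx.
have e2 : 0 < e / 2 by rewrite divr_gt0.
have /cvgrPdist_le/(_ _ e2)[r /= r0 cr] := cc x.
exists r => // y /= xyr xy.
have near z : x <= z <= y -> `|c x - c z| <= e / 2.
  move=> /andP[xz zy]; apply: cr => /=; apply: le_lt_trans xyr.
  by rewrite !ler0_norm ?subr_le0//; lra.
have h1 : enorm (G y - G x) <= (c x + e / 2) * (y - x).
  apply: sb => // z /near; rewrite ler_norml => /andP[h _]; rewrite -/(c z); lra.
have h2 : (- Phi) y - (- Phi) x <= (e / 2 - c x) * (y - x).
  apply: (@MVT_le _ _ (fun z => - c z)) => // z /[dup] xzy /near.
    by case/andP: xzy => xz _ _; apply: is_deriveN; exact/dPhi/(le_trans x0).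
  rewrite ler_norml => /andP[_ h]; lra.
have h3 := ler_enormD (G y - G x) (G x - G s).
rewrite subrKA in h3.
rewrite /H /m !max_r ?(le_trans sx)//.
by move: h2; rewrite !fctE; lra.
Qed.

Definition speed_bounded_on (k : Rplus R -> cldom Omega0 -> R) (a b : R)
    (g : curve Omega0) :=
  forall s t M : R, a <= s -> s <= t -> t <= b ->
    (forall r, s <= r <= t -> k (rplus r) (g (rplus r)) <= M) ->
    enorm (in_space g t - in_space g s) <= M * (t - s).

Lemma speed_bounded_on_cat (a b c : R) g :
  speed_bounded_on k a b g -> speed_bounded_on k b c g -> speed_bounded_on k a c g.
Proof.
move=> gab gbc s t M as_ st tc kM.
have [tb|/ltW bt] := leP t b; first exact: gab.
have [sb|/ltW bs] := leP s b; last exact: gbc.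
rewrite (le_trans (ler_enormB _ _ (in_space g b)))//.
have -> : M * (t - s) = M * (t - b) + M * (b - s) by ring.
apply: lerD.
  by apply: gbc => // r /andP[br rt]; apply: kM; rewrite rt (le_trans sb).
by apply: gab => // r /andP[sr rb]; apply: kM; rewrite sr (le_trans rb).
Qed.

Lemma slow_speed_bounded_on (a b : R) g :
  (forall s t : R, a <= s -> s <= t -> t <= b ->
    enorm (in_space g t - in_space g s) <= kmin * (t - s)) ->
  speed_bounded_on k a b g.
Proof.
move=> slow s t M as_ st tb kM; rewrite (le_trans (slow _ _ as_ st tb))//.
rewrite ler_wpM2r ?subr_ge0//.
have := kM s; rewrite lexx st => /(_ isT); apply: le_trans.
by have /andP[] := kb (rplus s) (g (rplus s)).
Qed.

Lemma onto_half_line (F : R -> R) : F 0 = 0 ->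
  (forall t : R, 0 <= t -> derivable F t 1) ->
  (forall s t : R, 0 <= s -> s <= t -> kmin * (t - s) <= F t - F s) ->
  forall v, 0 <= v -> exists2 t : R, 0 <= t & F t = v.
Proof.
move=> F0 dF Flb v v0.
have vk0 : 0 <= v / kmin by rewrite divr_ge0// ltW.
have cF : {within `[0, v / kmin], continuous F}.
  by apply: derivable_within_continuous => r /[!in_itv]/= /andP[r0 _]; exact: dF.
have := IVT vk0 cF (v := v); rewrite F0.
have vF : v <= F (v / kmin).
  have := Flb 0 (v / kmin) (lexx _) vk0.
  by rewrite F0 !subr0 mulrC divfK// gt_eqF.
rewrite min_l ?max_r ?(le_trans v0 vF)// v0 vF => /(_ isT)[t].
by rewrite in_itv/= => /andP[t_ge0 _] Ft; exists t.
Qed.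

(** A curve that starts following [b] at time [del], instead of time 0, cannot
    follow it with the same delay, since the admissible speed depends on time.
    The clock [th] is chosen so that the delay, measured by the primitive [Phi] of
    the speed bound along [b], is [err r = kmax * del * expR (L * r)] as long as
    [Phi r] exceeds it. Since [b r] and [b (th r)] are at distance at most [err r],
    the speed allowed at [b (th r)] is at least that at [b r] minus
    [L * err r], and this is the derivative of [Phi - err], because
    [err' = L * err]. *)
Lemma delayed_clock b (del t0 T : R) :
  speed_bounded k b -> continuous b ->
  0 <= del -> del <= T -> 0 <= t0 -> t0 <= T ->
  kmax * del * expR (L * T) <= kmin * (T - t0) ->
  L * (kmax * del * expR (L * T)) <= kmin ->
  exists th : R -> R, [/\ th del = 0, (exists2 t, del <= t <= T & th t = t0) &
    forall g, (forall r, del <= r <= T -> in_space g r = in_space b (th r)) ->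
      speed_bounded_on k del T g].
Proof.
move=> sb cb del0 delT t00 t0T arrive slow.
pose kap (r : R) : R := k (rplus r) (b (rplus r)).
have [Phi Phi0 dPhi] := antiderivative (kc cb).
have kapb r : kmin <= kap r <= kmax by exact: kb.
have Phiub (s t : R) : 0 <= s -> s <= t -> Phi t - Phi s <= kmax * (t - s).
  move=> s0 st; apply: (MVT_le st (f' := kap)) => r /andP[sr rt].
    exact/dPhi/(le_trans s0).
  by have /andP[] := kapb r.
have Philb (s t : R) : 0 <= s -> s <= t -> kmin * (t - s) <= Phi t - Phi s.
  move=> s0 st; rewrite -[leRHS]opprB -lerNr -mulNr.
  rewrite -[X in X - _]opprK opprK -[leLHS]/(Phi s - Phi t).
  have := @MVT_le _ (- Phi) (fun r => - kap r) s t (- kmin) st.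
  rewrite !fctE opprK addrC; apply=> r /andP[sr rt].
    exact/is_deriveN/dPhi/(le_trans s0).
  by rewrite lerN2; have /andP[] := kapb r.
have Phimono (s t : R) : 0 <= s -> 0 <= t -> Phi s <= Phi t -> s <= t.
  move=> s0 t_ge0; apply: contraTT; rewrite -!ltNge => ts.
  rewrite -subr_gt0 (lt_le_trans _ (Philb t s t_ge0 (ltW ts)))//.
  by rewrite mulr_gt0// subr_gt0.
have Phi_ge0 t : 0 <= t -> 0 <= Phi t.
  move=> t_ge0; have := Philb 0 t (lexx _) t_ge0; rewrite Phi0 !subr0.
  by apply: le_trans; rewrite mulr_ge0// ltW.
have dervPhi (t : R) : 0 <= t -> derivable Phi t 1.
  by move=> t_ge0; have [] := dPhi t t_ge0.
have kd0 : 0 <= kmax * del by rewrite mulr_ge0// ltW.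
pose err (r : R) := kmax * del * expR (L * r).
have err_ge0 r : 0 <= err r by rewrite mulr_ge0// expR_ge0.
have errT r : r <= T -> err r <= kmax * del * expR (L * T).
  by move=> rT; rewrite ler_wpM2l// ler_expR ler_pM2l.
pose m (r : R) := Phi r - err r.
have dm (r : R) : 0 <= r -> is_derive r 1 m (kap r - L * err r).
  move=> r0; apply: is_deriveB; first exact: dPhi.
  have -> : err = (kmax * del) *: (expR \o ( *%R L)) by apply/funext.
  have dL : is_derive r 1 ( *%R L) L.
    have -> : *%R L = L *: (@idfun R) by [].
    by have := is_deriveZ L (is_derive_id r (1 : R)); rewrite [_ *: 1]mulr1.
  have := is_deriveZ (kmax * del) (is_derive1_comp (is_derive_expR (L * r)) dL).
  move=> /is_derive_eq; apply; rewrite -[(_ *: _) r]/(kmax * del * expR (L * r)).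
  by rewrite -[_ *: _]/(kmax * del * (expR (L * r) * L)); ring.
have /choice[th thP] : forall r, exists u : R,
    0 <= u /\ Phi u = Num.max 0 (m r).
  move=> r; have [|u u0 Pu] := onto_half_line Phi0 dervPhi Philb (v := Num.max 0 (m r)).
    by rewrite le_max lexx.
  by exists u.
have th_ge0 r : 0 <= th r by have [] := thP r.
have Phith r : Phi (th r) = Num.max 0 (m r) by have [] := thP r.
(* The factor [kmax * del] in [err] is what makes [th] start at 0 at time [del]. *)
have mdel : m del <= 0.
  have := Phiub 0 del (lexx _) del0; rewrite Phi0 !subr0 => h.
  rewrite /m subr_le0 (le_trans h)// /err ler_peMr//.
  by rewrite -expR0 ler_expR mulr_ge0// ltW.
exists th; split.
- have Pth : Phi (th del) = Phi 0 by rewrite Phith max_l// Phi0.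
  by apply/eqP; rewrite eq_le; apply/andP; split; apply: Phimono; rewrite ?Pth ?lexx.
- have cm : {within `[del, T], continuous m}.
    apply: derivable_within_continuous => r /[!in_itv]/= /andP[r0 _].
    by have [] := dm r (le_trans del0 r0).
  have mT : Phi t0 <= m T.
    rewrite /m lerBrDr -lerBrDl (le_trans (errT T (lexx _)))// (le_trans arrive)//.
    exact: Philb.
  have mdelt : m del <= Phi t0 by rewrite (le_trans mdel)// Phi_ge0.
  have := IVT delT cm (v := Phi t0).
  rewrite (min_l (le_trans mdelt mT)) (max_r (le_trans mdelt mT)) mdelt mT => /(_ isT)[t].
  rewrite in_itv/= => tI mt; exists t => //.
  have Pth : Phi (th t) = Phi t0 by rewrite Phith mt max_r// Phi_ge0.
  by apply/eqP; rewrite eq_le; apply/andP; split; apply: Phimono; rewrite ?Pth ?lexx.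
move=> g gE s t M dels st tT kM.
have s0 : 0 <= s := le_trans del0 dels.
have t_ge0 : 0 <= t := le_trans s0 st.
have bPhi (u v : R) : 0 <= u -> u <= v ->
    enorm (in_space b v - in_space b u) <= Phi v - Phi u.
  exact: speed_bounded_antiderivative.
have bPhi' (u v : R) : 0 <= u -> 0 <= v ->
    enorm (in_space b v - in_space b u) <= `|Phi v - Phi u|.
  move=> u0 v0; have [uv|/ltW vu] := leP u v.
    exact: le_trans (bPhi _ _ u0 uv) (ler_norm _).
  by rewrite enormB distrC (le_trans (bPhi _ _ v0 vu))// ler_norm.
rewrite !gE ?dels ?tT ?(le_trans dels)// ?(le_trans st)//.
rewrite (le_trans (bPhi' _ _ _ _))// !Phith (le_trans (max_contract _ _ _))//.
have kin r : s <= r <= t -> `|kap r - L * err r| <= M.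
  move=> /[dup] srt /andP[sr rt].
  have r0 : 0 <= r := le_trans s0 sr.
  have rT : r <= T := le_trans rt tT.
  have rdel : del <= r := le_trans dels sr.
  have kgM := kM r srt.
  have gr : cldom_val (g (rplus r)) = in_space b (th r).
    by rewrite -[LHS]/(in_space g r) gE// rdel.
  have thr : th r <= r.
    apply: Phimono => //; rewrite Phith ge_max Phi_ge0//=.
    by rewrite /m gerBl.
  have dist : enorm (in_space b r - in_space b (th r)) <= err r.
    rewrite (le_trans (bPhi _ _ _ thr))// Phith lerBlDr.
    by rewrite -lerBlDl -/(m r) le_max lexx orbT.
  have := kL (rplus r) (b (rplus r)) (g (rplus r)).
  rewrite gr -[cldom_val (b _)]/(in_space b r).
  have Ldist : L * enorm (in_space b r - in_space b (th r)) <= L * err r.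
    by rewrite ler_pM2l.
  move=> /le_trans/(_ Ldist); rewrite ler_norml => /andP[_ h1].
  have /andP[kr1 _] := kapb r.
  have /andP[kg1 _] := kb (rplus r) (g (rplus r)).
  have Lerr : L * err r <= kmin.
    by apply: le_trans slow; rewrite ler_pM2l// errT.
  move: h1 kr1 kg1 kgM; rewrite -/(kap r) => h1 kr1 kg1 kgM.
  rewrite ler_norml; apply/andP; split.
    rewrite lerNl opprB (le_trans _ kgM)// (le_trans _ kg1)//.
    by rewrite (le_trans _ Lerr)// gerBl (le_trans (ltW kmin0)).
  by rewrite (le_trans _ kgM)// lerBlDr -lerBlDl.
rewrite ler_norml; apply/andP; split.
  have := @MVT_le _ (- m) (fun r => - (kap r - L * err r)) s t M st.
  rewrite !fctE opprK addrC -[X in _ -> _ -> X <= _]opprB => h.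
  rewrite lerNl; apply: h => r /[dup] srt /kin.
    by move=> _; apply: is_deriveN; apply: dm; case/andP: srt => /(le_trans s0).
  by rewrite ler_norml lerNl => /andP[].
apply: (MVT_le st (f' := fun r => kap r - L * err r)).
  by move=> r /andP[sr _]; apply: dm; exact: le_trans sr.
by move=> r /kin; rewrite ler_norml => /andP[].
Qed.

(** From [y] close to the starting point [b 0], walk to [b 0] at speed [kmin]
    along a path given by [geodesic_bound], which takes a short time [del], follow
    [b] along [delayed_clock] until [t0 + e], and stop. *)
Lemma reach_nearby (D : R) b (t0 e : R) :
  0 < D -> geodesic_bound (closure Omega) D ->
  speed_bounded k b -> continuous b -> 0 <= t0 -> 0 < e ->
  exists2 r, 0 < r & forall y : cldom Omega0,
    enorm (cldom_val y - in_space b 0) < r ->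
    exists g, [/\ speed_bounded k g, g (rplus 0) = y &
      exists2 t, 0 <= t <= t0 + e & in_space g t = in_space b t0].
Proof.
move=> D0 geo sb cb t00 e0.
pose T := t0 + e.
have T0 : 0 < T by rewrite ltr_wpDl.
pose E := expR (L * T).
have E0 : 0 < E by exact: expR_gt0.
pose del0 := Num.min e (Num.min (kmin / (L * kmax * E)) (kmin * e / (kmax * E))).
have del00 : 0 < del0.
  by rewrite !lt_min e0 !divr_gt0// !mulr_gt0.
exists (kmin * del0 / D); first by rewrite divr_gt0// mulr_gt0.
move=> y yb.
set x := in_space b 0 in yb.
have [c [cc c0 c1 cA cl]] := geo _ _ (cldom_valP (x := y)) (cldom_valP (x := b (rplus 0))).
rewrite -[cldom_val (b _)]/x in cl c1.
pose l := D * enorm (cldom_val y - x).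
have l0 : 0 <= l by rewrite mulr_ge0 ?enorm_ge0// ltW.
have [w [w0 w1 wc wlip]] := unit_speed_param l0 cc cl.
have wA s : closure Omega (w s).
  by have [t t01 ->] := wc s; apply: cA; exists t => //=; rewrite in_itv/=.
pose del := l / kmin.
have del_ge0 : 0 <= del by rewrite divr_ge0// ltW.
have dk : kmin * del = l by rewrite /del mulrC divfK// gt_eqF.
have deldel : del <= del0.
  have yb2 : l <= kmin * del0 by rewrite /l [leLHS]mulrC -ler_pdivlMr// ltW.
  by rewrite /del ler_pdivrMr// [leRHS]mulrC.
have [del1 [del2 del3]] : del <= e /\ del <= kmin / (L * kmax * E) /\
    del <= kmin * e / (kmax * E).
  by move: deldel; rewrite /del0 !le_min => /andP[-> /andP[-> ->]].
have deltaT : del <= T by rewrite (le_trans del1)// /T lerDr.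
have t0T : t0 <= T by rewrite /T lerDl ltW.
have arrive : kmax * del * expR (L * T) <= kmin * (T - t0).
  have -> : T - t0 = e by rewrite /T addrAC subrr add0r.
  move: del3; rewrite ler_pdivlMr ?mulr_gt0// -/E.
  by rewrite mulrCA mulrA.
have slow : L * (kmax * del * expR (L * T)) <= kmin.
  move: del2; rewrite ler_pdivlMr ?mulr_gt0// -/E.
  by congr (_ <= _); ring.
have [th [th0 [t tI tht] chase]] :=
  delayed_clock sb cb del_ge0 deltaT t00 t0T arrive slow.
pose gam (t : R) : 'rV[R]_d :=
  if t <= del then w (kmin * t) else in_space b (th (Num.min t T)).
have gamA u : closure Omega (gam u).
  by rewrite /gam; case: ifP => _; [exact: wA|exact: cldom_valP].
pose g : curve Omega0 := fun u => to_cldom Omega0 (gam (rplus_val u)).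
have gE u : 0 <= u -> in_space g u = gam u.
  by move=> u0; rewrite /in_space /g rplusK// to_cldomK.
have gE2 u : del <= u -> in_space g u = in_space b (th (Num.min u T)).
  move=> du; rewrite gE ?(le_trans del_ge0)// /gam; case: (ltgtP u del) du => // -> _.
  by rewrite dk w1 min_l// th0.
exists g; split.
- suff h : forall v, speed_bounded_on k 0 v g.
    by move=> s u M s0 su; exact: (h u).
  move=> v; apply: (@speed_bounded_on_cat _ del).
    apply: slow_speed_bounded_on => s u s0 su udel.
    rewrite !gE ?(le_trans s0)// /gam udel (le_trans su udel).
    by rewrite mulrBr wlip ?mulr_ge0 ?(ltW kmin0)// ler_pM2l.
  apply: (@speed_bounded_on_cat _ T).
    by apply: chase => r /andP[dr rT]; rewrite gE2// min_l.
  apply: slow_speed_bounded_on => s u Ts su uv.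
  rewrite !gE2 ?(le_trans deltaT)// ?(le_trans Ts)//.
  rewrite !min_r ?(le_trans Ts)// subrr enorm0 mulr_ge0 ?subr_ge0//.
  exact: ltW.
- apply: cldom_val_inj; rewrite -[LHS]/(in_space g 0) gE// /gam del_ge0.
  by rewrite mulr0 w0 c0.
case/andP: tI => dt tT.
exists t; first by rewrite (le_trans del_ge0).
by rewrite gE2// min_l// tht.
Qed.

End delayed_following.

(** * Neighbourhoods of a path *)

Section path_topology.
Context (R : realType) (d : nat) (Omega : set 'rV[R]_d).
Variable Omega0 : Omega !=set0.
Implicit Types (g h : paths Omega0).

Lemma continuous_path_fun g : continuous (path_fun g).
Proof. exact: cts_fun. Qed.

Lemma compact_rplus_itv (n : R) :
  compact [set t : Rplus R | rplus_val t <= n].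
Proof.
have -> : [set t : Rplus R | rplus_val t <= n] = @rplus R @` `[0, n].
  apply/seteqP; split => [t tn|_ [t /= /[!in_itv]/= /andP[t0 tn] <-]]/=.
    by exists (rplus_val t); rewrite ?rplus_valK//= in_itv/= rplus_val_ge0.
  by rewrite rplusK.
apply: continuous_compact; last exact: segment_compact.
by apply: continuous_subspaceT; exact: continuous_rplus.
Qed.

Lemma near_path (g : paths Omega0) (n e : R) : 0 < e ->
  nbhs g [set h : paths Omega0 | forall t, 0 <= t <= n ->
    enorm (in_space (path_fun h) t - in_space (path_fun g) t) < e].
Proof.
move=> e0.
have d1 : (0 : R) < d%:R + 1 by rewrite ltr_wpDl.
have ed : 0 < e / (d%:R + 1) by rewrite divr_gt0.
pose E : set (cldom Omega0 * cldom Omega0) :=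
  [set xy | ball xy.1 (e / (d%:R + 1)) xy.2].
have entE : entourage E by exact: entourage_ball (PosNum ed).
have := fam_nbhs (path_fun g) entE (@compact_rplus_itv n).
have cg : path_fun x @[x --> g] --> path_fun g.
  exact: (@initial_continuous _ _ (@path_fun R d Omega Omega0) g).
move/cg => near_g; apply: (@filterS _ (nbhs g) _ _ _ _ near_g).
move=> h /= gh t /andP[t0 tn].
have := gh (rplus t); rewrite rplusK// => /(_ tn).
rewrite /E /= -[ball _ _ _]/(ball (in_space (path_fun g) t) (e / (d%:R + 1))
  (in_space (path_fun h) t)) -ball_normE /= => lt.
rewrite enormB (le_lt_trans (enorm_le_normr _))//.
move: lt; rewrite ltr_pdivlMr// mulrC; apply: le_lt_trans.
by rewrite ler_wpM2r// lerDl.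
Qed.

(** The filter generated by the sets on the right-hand side converges to [g]
    uniformly on compact sets, since these are bounded. *)
Lemma path_nbhs_basis g (U : set (paths Omega0)) : nbhs g U ->
  exists (n : nat) (e : R), 0 < e /\
    forall h, (forall t, 0 <= t <= n%:R ->
      `|in_space (path_fun h) t - in_space (path_fun g) t| < e) -> U h.
Proof.
move=> [V [[W oW WV] /= Vg] VU].
pose B (ne : nat * R) : set {family compact, Rplus R -> cldom Omega0} :=
  [set h | forall t, 0 <= t <= ne.1%:R ->
     `|in_space h t - in_space (path_fun g) t| < ne.2].
pose F := filter_from [set ne : nat * R | 0 < ne.2] B.
have FF : Filter F.
  apply: filter_from_filter; first by exists (0%N, 1) => /=.
  move=> [n1 e1] [n2 e2] /= e10 e20; exists (maxn n1 n2, Num.min e1 e2) => /=.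
    by rewrite lt_min e10.
  move=> h Bh; split => t /= /andP[t0 tn].
    have := Bh t; rewrite /= t0 lt_min => h1.
    have : t <= (maxn n1 n2)%:R by rewrite (le_trans tn)// ler_nat leq_maxl.
    by move=> /h1 /andP[].
  have := Bh t; rewrite /= t0 lt_min => h1.
  have : t <= (maxn n1 n2)%:R by rewrite (le_trans tn)// ler_nat leq_maxr.
  by move=> /h1 /andP[].
have cvgF : {family compact, F --> (path_fun g : _ -> _)}.
  apply/fam_cvgP => A cA P /uniform_nbhs[E [entE EP]].
  have [n An] : exists n : nat, forall t : Rplus R, A t -> rplus_val t <= n%:R.
    have cvA : compact (@rplus_val R @` A).
      apply: continuous_compact => //; apply: continuous_subspaceT.
      exact: continuous_rplus_val.
    have [M [_ hM]] := compact_bounded cvA.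
    exists (Num.truncn (`|M| + 1)).+1 => t At.
    apply: (@le_trans _ _ (`|M| + 1)); last by rewrite ltW// truncnS_gt.
    have M1 : M < `|M| + 1 by rewrite (le_lt_trans (ler_norm M))// ltrDl.
    by rewrite (le_trans (ler_norm _))//; apply: (hM _ M1); exists t.
  move: entE; rewrite -entourage_ballE => -[e /= e0 subE].
  exists (n, e) => //= h hB; apply: EP => t At; apply: subE => /=.
  rewrite -[ball _ _ _]/(ball (cldom_val (path_fun g t)) e (cldom_val (h t))).
  rewrite -ball_normE /= distrC.
  have := hB (rplus_val t); rewrite rplus_val_ge0 An// => /(_ isT).
  by rewrite !in_space_rplus.
have : F W.
  apply: cvgF; apply: open_nbhs_nbhs; split => //.
  by move: Vg; rewrite -WV.
move=> [[n e] /= e0 BW]; exists n, e; split => // h hB.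
by apply: VU; rewrite -WV; apply: BW.
Qed.

End path_topology.

(** * Continuity of the marginals in time *)

Lemma continuous_borel_measurable (R : realType) (X : ptopologicalType)
    (f : X -> R) :
  continuous f -> measurable_fun setT (f : borel X -> R).
Proof.
move=> cf.
apply: (measurability _ (RGenOpens.measurableE R)) => _ [_ [a [b ->]] <-].
rewrite setTI; apply: sub_sigma_algebra.
by apply: (proj1 (continuousP f) cf); exact: interval_open.
Qed.

Section push_eval_continuity.
Context (R : realType) (d : nat) (Omega : set 'rV[R]_d).
Variable Omega0 : Omega !=set0.

Lemma integrate_push_eval (Q : Prob R (paths Omega0)) (t : Rplus R)
    (f : test_fun R (cldom Omega0)) :
  integrate f (push_eval t Q) =
  (\int[Q]_(g in [set: borel (paths Omega0)]) (sval f (path_fun g t)))%R.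
Proof.
have [cf bf] := svalP f.
have mf : measurable_fun setT (sval f : borel (cldom Omega0) -> R).
  exact: continuous_borel_measurable.
have mfe : measurable_fun setT (fun g : borel (paths Omega0) => sval f (path_fun g t)).
  exact: (measurableT_comp mf (measurable_eval_at t)).
rewrite /integrate /Rintegral /push_eval integral_distribution//.
  exact/measurable_EFinP.
apply: measurable_bounded_integrable => //.
  by rewrite (le_lt_trans (probability_le1 _ _))// ltry.
have [M [Mr hM]] := bf; exists M; split => // x Mx g _ /=.
exact: hM.
Qed.

(** By the definition of the narrow topology, this is dominated convergence. *)
Lemma continuous_push_eval (Q : Prob R (paths Omega0)) :
  continuous (fun t : R => push_eval (rplus t) Q).
Proof.
move=> t; apply/cvg_sup => f.
suff c : continuous (fun t : R => integrate f (push_eval (rplus t) Q)).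
  exact: (@continuous_comp_initial _ _ _ (integrate f)
    (fun t : R => push_eval (rplus t) Q) c t).
move=> {}t; have [cf bf] := svalP f.
have [M M0 hM] : exists2 M : R, 0 < M & forall x, `|sval f x| <= M.
  have [M [Mr hM]] := bf; exists (`|M| + 1); first by rewrite ltr_wpDl.
  by move=> x; apply: hM => //; rewrite (le_lt_trans (ler_norm M))// ltrDl.
under eq_fun do rewrite integrate_push_eval.
have mf (s : R) : measurable_fun setT
    (fun g : borel (paths Omega0) => sval f (path_fun g (rplus s))).
  apply: (measurableT_comp (f := (sval f : borel (cldom Omega0) -> R))).
    exact: continuous_borel_measurable.
  exact: measurable_eval_at.
have Qfin : (Q setT < +oo)%E.
  by rewrite (le_lt_trans (probability_le1 _ _))// ltry.
have tI : t \in `]t - 1, t + 1[%classic by rewrite inE/= in_itv/=; lra.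
apply: (@continuity_under_integral _ _ _ Q
  (fun s g => sval f (path_fun g (rplus s))) setT measurableT (t - 1) (t + 1)
  _ _ (fun=> M)) tI.
- move=> s _; apply: measurable_bounded_integrable => //.
  exists M; split; first exact: num_real.
  by move=> x Mx g _ /=; exact: le_trans (hM _) (ltW Mx).
- apply: aeW => g _ s _.
  apply: (@continuous_comp _ _ _ (fun s => path_fun g (rplus s)) (sval f)); last exact: cf.
  apply: continuous_comp; first exact: continuous_rplus.
  exact: continuous_path_fun.
- exact: (@finite_measure_integrable_cst _ _ _ Q _ M).
- by move=> s _; apply: aeW => g _.
Qed.

End push_eval_continuity.

(** * The support has full measure *)

Lemma uniform_continuity_segment (R : realType) (V : normedModType R) (G : R -> V) (n e : R) :
  continuous G -> 0 < e ->
  exists2 r, 0 < r & forall x y, 0 <= x <= n -> `|x - y| < r -> `|G x - G y| < e.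
Proof.
move=> cG e0.
have := @segment_compact R 0 n; rewrite compact_near_coveringP => cov.
pose P (r x : R) := forall y, `|x - y| < r -> `|G x - G y| < e.
have : \forall r \near 0^'+, `[0, n]%classic `<=` P r.
  apply: cov => x _.
  have e2 : 0 < e / 2 by rewrite divr_gt0.
  have /cvgrPdist_lt/(_ _ e2)[r /= r0 xr] := cG x.
  have r2 : 0 < r / 2 by rewrite divr_gt0.
  exists ([set x' | `|x - x'| < r / 2], [set s : R | s < r / 2]) => /=.
    split; first by exists (r / 2).
    exact: nbhs_right_lt.
  move=> [x' s] /= [xx' sr] y x'y.
  have h1 : `|G x - G x'| < e / 2 by apply: xr => /=; lra.
  have h2 : `|G x - G y| < e / 2.
    apply: xr => /=; rewrite -(subrKA x') (le_lt_trans (ler_normD _ _))//; lra.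
  rewrite -(subrKA (G x)) (le_lt_trans (ler_normD _ _))//.
  by rewrite [X in X + _]distrC; lra.
move=> Pr.
have : \forall r \near (0:R)^'+, 0 < r /\ `[0, n]%classic `<=` P r.
  by near=> r; split; near: r => //; exact: nbhs_right_gt.
move=> /filter_ex[r [r0 rP]]; exists r => // x y x0n.
by apply: (rP x); rewrite /= in_itv.
Unshelve. all: by end_near. Qed.

Section support.
Context (R : realType) (d : nat) (Omega : set 'rV[R]_d).
Variable Omega0 : Omega !=set0.

(** Countably many classes that cover the space of paths for given [n] and [m],
    and such that two paths of the same class are uniformly close on [[0, n]]. *)
Definition near_step (c : nat * nat * nat * seq 'rV[rat]_d) : set (paths Omega0) :=
  let: (n, p, m, s) := c in
  [set h | forall t, 0 <= t <= n%:R ->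
    `|in_space (path_fun h) t
      - map_mx ratr (nth 0 s (Num.truncn (t * p.+1%:R)))| < m.+1%:R^-1].

Lemma in_near_step (g : paths Omega0) (n m : nat) :
  exists p s, near_step (n, p, m, s) g.
Proof.
have m0 : (0 : R) < m.+1%:R^-1 / 2 by rewrite divr_gt0.
have cg := continuous_in_space (@continuous_path_fun _ _ _ _ g).
have [r r0 gr] := uniform_continuity_segment n%:R cg m0.
pose p := Num.truncn r^-1.
have pr : (p.+1%:R^-1 : R) < r by rewrite invf_plt ?posrE// truncnS_gt.
have ex (i : nat) : exists q : 'rV[rat]_d,
    `|in_space (path_fun g) (i%:R / p.+1%:R) - map_mx ratr q| < m.+1%:R^-1 / 2.
  exact: rat_row_approx.
have [q gq] := choice ex.
exists p, (map q (iota 0 (n * p.+1).+1)) => t /andP[t0 tn].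
set j := Num.truncn _.
have tp0 : 0 <= t * p.+1%:R by rewrite mulr_ge0.
have /andP[j1 j2] := truncn_itv tp0; rewrite -/j in j1 j2.
have jn : (j < (n * p.+1).+1)%N.
  rewrite ltnS -(ler_nat R) (le_trans j1)// natrM ler_wpM2r//.
rewrite (nth_map 0%N) ?size_iota// nth_iota// add0n.
rewrite -(subrKA (in_space (path_fun g) (j%:R / p.+1%:R))).
rewrite (le_lt_trans (ler_normD _ _))// [ltRHS](splitr (m.+1%:R^-1)) ltrD//.
apply: gr; first by rewrite t0.
apply: le_lt_trans pr.
rewrite ger0_norm; last by rewrite subr_ge0 ler_pdivrMr.
have e1 : p.+1%:R^-1 + j%:R / p.+1%:R = j.+1%:R / p.+1%:R :> R.
  by rewrite -[j.+1]addn1 natrD mulrDl mul1r addrC.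
by rewrite lerBlDr e1 ler_pdivlMr// ltW.
Qed.

(** A path outside the support has a null neighbourhood, which contains one of
    the countably many sets [near_step c] that the path belongs to. *)
Lemma supp_full (Q : Prob R (paths Omega0)) : Q.-negligible (~` supp Q).
Proof.
pose F (k : nat) : set (borel (paths Omega0)) :=
  if unpickle k is Some c then
    if `[< Q.-negligible (near_step c : set (borel (paths Omega0))) >]
    then near_step c else set0
  else set0.
have : Q.-negligible (\bigcup_k F k).
  apply: negligible_bigcup => k; rewrite /F.
  case: unpickle => [c|]; last exact: negligible_set0.
  by case: asboolP => // _; exact: negligible_set0.
apply: negligibleS => g /=.
rewrite /supp /= => /existsNP[U /not_implyP[oU /not_implyP[Ug QU]]].
have QU0 : Q U = 0%E.
  by apply/eqP; rewrite eq_le measure_ge0 andbT leNgt; exact/negP.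
have [n [e [e0 sub]]] := path_nbhs_basis (open_nbhs_nbhs (conj oU Ug)).
have e2 : 0 < e / 2 by rewrite divr_gt0.
pose m := Num.truncn (e / 2)^-1.
have me : (m.+1%:R^-1 : R) < e / 2 by rewrite invf_plt ?posrE// truncnS_gt.
have [p [s gs]] := in_near_step g n m.
exists (pickle (n, p, m, s)); [exact: I|rewrite /F pickleK].
rewrite asboolT//.
exists U; split => //; first exact: sub_sigma_algebra.
move=> h hs; apply: sub => t tn.
have := gs t tn; have := hs t tn.
set v := map_mx _ _ => h1 h2.
rewrite -(subrKA v) (le_lt_trans (ler_normD _ _))// [X in _ + X]distrC.
rewrite [ltRHS]splitr ltrD// (lt_trans _ me)//.
Qed.

End support.

(** * Limits of optimal curves *)

Section limits.
Context (R : realType) (d : nat) (Omega : set 'rV[R]_d).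
Variable Omega0 : Omega !=set0.
Implicit Types (g h : curve Omega0).

Lemma speed_bounded_limit (k : Rplus R -> cldom Omega0 -> R) (L : R) g : 0 < L ->
  (forall t x y, `|k t x - k t y| <= L * enorm (cldom_val x - cldom_val y)) ->
  (forall n e : R, 0 < e -> exists2 h, speed_bounded k h &
    forall t, 0 <= t <= n -> enorm (in_space h t - in_space g t) < e) ->
  speed_bounded k g.
Proof.
move=> L0 kL approx s t M s0 st kM.
have ts0 : 0 <= t - s by rewrite subr_ge0.
pose c := 2 + L * (t - s).
have c0 : 0 < c by rewrite ltr_wpDr// mulr_ge0// ltW.
apply/ler_addgt0Pr => e e0.
have ec : 0 < e / c by rewrite divr_gt0.
have [h sh hg] := approx t (e / c) ec.
have hs : enorm (in_space g s - in_space h s) < e / c.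
  by rewrite enormB; apply: hg; rewrite s0.
have ht : enorm (in_space h t - in_space g t) < e / c.
  by apply: hg; rewrite lexx (le_trans s0).
have hst : enorm (in_space h t - in_space h s) <= (M + L * (e / c)) * (t - s).
  apply: sh => // r /andP[sr rt].
  have r0 := le_trans s0 sr.
  have hgr : enorm (in_space h r - in_space g r) < e / c by apply: hg; rewrite r0.
  have := kL (rplus r) (h (rplus r)) (g (rplus r)).
  rewrite -[cldom_val (h _)]/(in_space h r) -[cldom_val (g _)]/(in_space g r).
  have : L * enorm (in_space h r - in_space g r) <= L * (e / c).
    by rewrite ler_pM2l// ltW.
  have := kM r; rewrite sr rt => /(_ isT).
  rewrite ler_norml; move=> h1 h2 /andP[_ h3]; lra.
have ee : e / c * (2 + L * (t - s)) = e by rewrite divfK// gt_eqF.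
have tri1 := ler_enormB (in_space g t) (in_space g s) (in_space h t).
have tri2 := ler_enormB (in_space h t) (in_space g s) (in_space h s).
rewrite (enormB (in_space g t) (in_space h t)) in tri1.
rewrite (enormB (in_space h s) (in_space g s)) in tri2.
lra.
Qed.

End limits.

Section exit.
Context (R : realType) (d : nat) (Omega : set 'rV[R]_d).
Variable Omega0 : Omega !=set0.
Variable Gamma : set 'rV[R]_d.
Implicit Types (g h : curve Omega0).

Lemma exit_time_le g (t : R) : 0 <= t -> Gamma (in_space g t) ->
  (exit_time Gamma (rplus 0) g <= t%:E)%E.
Proof.
move=> t0 Gt; apply: ereal_inf_lbound; exists t => //=.
by split => //; rewrite rplusK// addr0.
Qed.

Lemma exit_time_ge0 g : (0 <= exit_time Gamma (rplus 0) g)%E.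
Proof.
by apply: le_ereal_inf_tmp => _ [t [t0 _] <-]; rewrite lee_fin.
Qed.

Lemma exit_time_lt g (x : R) : (exit_time Gamma (rplus 0) g < x%:E)%E ->
  exists t, [/\ 0 <= t, t < x & Gamma (in_space g t)].
Proof.
move=> /ereal_inf_lt[_ [t [t0 Gt] <-]]; rewrite lte_fin => tx.
by exists t; split => //; move: Gt; rewrite rplusK// addr0.
Qed.

(** The curve is constant after its exit time, and meets [Gamma] at times
    arbitrarily close to it, hence at it. *)
Lemma Opt_stays k (x : cldom Omega0) g (T : R) : Opt Gamma k (rplus 0) x g ->
  (exit_time Gamma (rplus 0) g <= T%:E)%E -> forall t, T <= t ->
  in_space g t = in_space g T /\ Gamma (in_space g t).
Proof.
move=> [_ _ _ stay] gT t Tt.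
have tau0 := exit_time_ge0 g.
have fin : exit_time Gamma (rplus 0) g \is a fin_num.
  by rewrite ge0_fin_numE// (le_lt_trans gT)// ltry.
move: stay gT tau0; rewrite rplusK//.
case E : exit_time fin => [tau| |]// _ stay; rewrite !lee_fin => tauT tau0.
have {}stay s : tau <= s -> in_space g s = in_space g tau.
  move=> taus; rewrite /in_space.
  rewrite (stay (rplus s)) ?add0r//.
  by rewrite rplusK ?(le_trans tau0)// -EFinD add0r lee_fin.
have [t1 [t10 _ Gt1]] : exists t, [/\ 0 <= t, t < tau + 1 & Gamma (in_space g t)].
  by apply: exit_time_lt; rewrite E lte_fin ltrDl.
have tt1 : tau <= t1 by rewrite -lee_fin -E; exact: exit_time_le.
rewrite !(stay t) ?(stay T) ?(le_trans tauT)//; split => //.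
by rewrite -(stay t1).
Qed.

End exit.

Section main.
Context (R : realType) (d : nat) (Omega : set 'rV[R]_d).
Variable Omega0 : Omega !=set0.
Variables (Gamma : set 'rV[R]_d) (k : Rplus R -> cldom Omega0 -> R).
Variables (kmin kmax L D : R).
Hypothesis Gamma_closed : closed Gamma.
Hypothesis D0 : 0 < D.
Hypothesis geo : geodesic_bound (closure Omega) D.
Hypothesis kmin0 : 0 < kmin.
Hypothesis kb : forall t x, kmin <= k t x <= kmax.
Hypothesis L0 : 0 < L.
Hypothesis kL : forall t x y,
  `|k t x - k t y| <= L * enorm (cldom_val x - cldom_val y).
Hypothesis kc : forall g : curve Omega0, continuous g ->
  continuous (fun t : R => k (rplus t) (g (rplus t))).

Let O (g : curve Omega0) := Opt Gamma k (rplus 0) (g (rplus 0)) g.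

(** Upper semicontinuity of the minimal exit time with respect to the starting
    point. *)
Lemma Opt_exit_near (b : curve Omega0) (t0 e : R) :
  Adm k b -> 0 <= t0 -> Gamma (in_space b t0) -> 0 < e ->
  exists2 r : R, 0 < r & forall h, O h ->
    enorm (in_space h 0 - in_space b 0) < r ->
    (exit_time Gamma (rplus 0) h <= (t0 + e)%:E)%E.
Proof.
move=> Ab t00 Gb e0.
have k0 t x : 0 <= k t x by have /andP[h _] := kb t x; exact: le_trans (ltW kmin0) h.
have sb := Adm_speed_bounded k0 Ab.
have cb : continuous b by apply: lipschitz_curve_continuous; case: Ab.
have [r r0 reach] := reach_nearby kmin0 kb L0 kL kc D0 geo sb cb t00 e0.
exists r => // h Oh hb.
have [g [sg g0 [t /andP[t_ge0 tT] gt]]] := reach (h (rplus 0)) hb.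
have Ag := speed_bounded_Adm kmin0 kb (@kc g) sg.
have [_ _ -> _] := Oh.
apply: (@le_trans _ _ (exit_time Gamma (rplus 0) g)).
  by apply: ereal_inf_lbound; exists g.
apply: (@le_trans _ _ t%:E); last by rewrite lee_fin.
by apply: exit_time_le => //; rewrite gt.
Qed.

(** Optimal curves close to [g] on a long interval start close to [g 0], hence by
    [Opt_exit_near] have already stopped in [Gamma] slightly after the exit time of
    any competitor [b] of [g]. So [g] meets [Gamma] no later than [b]; for [b = g],
    it is constant after its exit time. *)
Lemma Opt_limit (g : curve Omega0) :
  (forall n e : R, 0 < e -> exists2 h, O h &
    forall t, 0 <= t <= n -> enorm (in_space h t - in_space g t) < e) ->
  O g.
Proof.
move=> approx.
have k0 t x : 0 <= k t x by have /andP[h _] := kb t x; exact: le_trans (ltW kmin0) h.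
have kM t x : k t x <= kmax by have /andP[] := kb t x.
have kmax0 : 0 <= kmax by exact: le_trans (k0 (rplus 0) (g (rplus 0))) (kM _ _).
have sg : speed_bounded k g.
  apply: (speed_bounded_limit L0 kL) => n e /(approx n)[h [Ah _ _ _] hg].
  by exists h => //; exact: Adm_speed_bounded.
have Ag := speed_bounded_Adm kmin0 kb (@kc g) sg.
have lip := speed_bounded_lipschitz kmax0 kM sg.
have near_opt (b : curve Omega0) (t0 e n e' : R) : Adm k b -> b (rplus 0) = g (rplus 0) ->
    0 <= t0 -> Gamma (in_space b t0) -> 0 < e -> 0 < e' ->
    exists h, [/\ O h, (exit_time Gamma (rplus 0) h <= (t0 + e)%:E)%E &
      forall t, 0 <= t <= n -> enorm (in_space h t - in_space g t) < e'].
  move=> Ab b0 t00 Gb e0 e'0.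
  have [r r0 near] := Opt_exit_near Ab t00 Gb e0.
  have m0 : 0 < Num.min r e' by rewrite lt_min r0.
  have [h Oh hg] := approx (Num.max 0 n) _ m0.
  exists h; split => //.
    apply: near => //; rewrite /in_space b0 -[cldom_val (g _)]/(in_space g 0).
    have := hg 0; rewrite lexx le_max lexx lt_min => /(_ isT) /andP[]//.
  move=> t /andP[tt0 tn].
  by have := hg t; rewrite tt0 le_max tn orbT lt_min => /(_ isT) /andP[].
split => //.
- move=> t; rewrite rplusK// => t0; congr g.
  have t_ge0 := rplus_val_ge0 t.
  have t00 : rplus_val t = 0 by apply/eqP; rewrite eq_le t0.
  by rewrite -[LHS]rplus_valK t00.
- apply/eqP; rewrite eq_le; apply/andP; split; last first.
    by apply: ereal_inf_lbound; exists g.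
  apply: le_ereal_inf_tmp => _ [b [Ab b0] <-].
  apply: le_ereal_inf_tmp => _ [t0 [t00 Gb] <-].
  rewrite rplusK// addr0 in Gb.
  apply/lee_addgt0Pr => e e0; rewrite -EFinD.
  have te0 : 0 <= t0 + e by rewrite addr_ge0// ltW.
  apply: exit_time_le => //.
  apply: Gamma_closed => U /nbhs_ballP[e' /= e'0 sub].
  have [h [Oh hexit hg]] := near_opt b t0 e (t0 + e) e' Ab b0 t00 Gb e0 e'0.
  exists (in_space h (t0 + e)); split.
    by have [] := Opt_stays Oh hexit (lexx _).
  apply: sub; rewrite -ball_normE /= (le_lt_trans (normr_le_enorm _))// enormB.
  by apply: hg; rewrite te0 lexx.
move=> t; rewrite rplusK//.
have tau0 := exit_time_ge0 Gamma g.
case E : exit_time tau0 => [tau| |]//; rewrite lee_fin => tau0.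
rewrite add0e lee_fin/= add0r => taut.
apply: cldom_val_inj.
rewrite -in_space_rplus -[RHS]/(in_space g tau).
move: (rplus_val t) taut => {}t taut.
have const (u : R) : tau < u -> u <= t -> in_space g t = in_space g u.
  move=> tauu ut.
  have [t0 [t00 t0u Gt0]] : exists t, [/\ 0 <= t, t < u & Gamma (in_space g t)].
    by apply: exit_time_lt; rewrite E lte_fin.
  have u_t0 : 0 < u - t0 by rewrite subr_gt0.
  apply/eqP; rewrite -subr_eq0; apply/eqP/enorm_eq0/eqP.
  rewrite eq_le enorm_ge0 andbT; apply/ler_addgt0Pl => e e0; rewrite addr0.
  have e2 : 0 < e / 2 by rewrite divr_gt0.
  have [h [Oh hexit hg]] := near_opt g t0 (u - t0) t (e / 2) Ag erefl t00 Gt0 u_t0 e2.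
  rewrite subrKC in hexit.
  have [htu _] := Opt_stays Oh hexit ut.
  have tri := ler_enormB (in_space g t) (in_space g u) (in_space h t).
  rewrite (enormB (in_space g t) (in_space h t)) {2}htu in tri.
  apply: (le_trans tri); rewrite (splitr e) lerD// ltW// hg//.
    by rewrite (le_trans tau0 taut) lexx.
  by rewrite (le_trans t00 (ltW t0u)).
move: taut; rewrite le_eqVlt => /predU1P[->//|taut].
apply/eqP; rewrite -subr_eq0; apply/eqP/enorm_eq0/eqP.
rewrite eq_le enorm_ge0 andbT; apply/ler_addgt0Pl => e e0; rewrite addr0.
have km1 : 0 < kmax + 1 by rewrite ltr_wpDl.
pose u := Num.min t (tau + e / (kmax + 1)).
have tauu : tau < u by rewrite lt_min taut ltrDl divr_gt0.
have ut : u <= t by rewrite ge_min lexx.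
have ue : u <= tau + e / (kmax + 1) by rewrite ge_min lexx orbT.
rewrite (const u)// (le_trans (lip _ _))// ger0_norm ?subr_ge0 ?(ltW tauu)//.
apply: (@le_trans _ _ ((kmax + 1) * (u - tau))).
  by rewrite ler_wpM2r ?subr_ge0 ?(ltW tauu)// lerDl.
by rewrite mulrC -ler_pdivlMr// lerBlDl.
Qed.

End main.

(** * Equilibria and support *)

Theorem proposition3p7 (R : realType) (d : nat) (Omega : set 'rV[R]_d)
    (Omega_neq0 : Omega !=set0) (Omega_open : open Omega)
    (Omega_bounded : bounded_set Omega) (Omega_connected : connected Omega)
    (Omega_geodesic : exists2 D : R, 0 < D & geodesic_bound (closure Omega) D)
    (Gamma : set 'rV[R]_d) (Gamma_sub : Gamma `<=` closure Omega)
    (Gamma_neq0 : Gamma !=set0) (Gamma_closed : closed Gamma)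
    (K : Prob R (cldom Omega_neq0) -> cldom Omega_neq0 -> R)
    (K_continuous :
      continuous (fun p : Prob R (cldom Omega_neq0) * cldom Omega_neq0 =>
        K p.1 p.2))
    (Kmin Kmax : R) (Kmin_gt0 : 0 < Kmin) (Kmax_gt0 : 0 < Kmax)
    (K_bounds : forall mu x, Kmin <= K mu x <= Kmax)
    (L : R) (L_gt0 : 0 < L)
    (K_lipschitz : forall mu x1 x2,
      `|K mu x1 - K mu x2| <= L * enorm (cldom_val x1 - cldom_val x2))
    (m0 : Prob R (cldom Omega_neq0)) (Q : Prob R (paths Omega_neq0)) :
  is_equilibrium Gamma K m0 Q <->
  eq_prob (push_eval (rplus 0) Q) m0 /\
  (forall g : paths Omega_neq0, supp Q g ->
    Opt Gamma (kQ K Q) (rplus 0) (path_fun g (rplus 0)) (path_fun g)).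
Proof.
split=> -[Qm0 QO]; split => //; last first.
  apply: negligibleS (supp_full Q) => g /= nO sg.
  exact/nO/QO.
move=> g sg.
have [D D0 geo] := Omega_geodesic.
have kb t x : Kmin <= kQ K Q t x <= Kmax by exact: K_bounds.
have kL t x y : `|kQ K Q t x - kQ K Q t y| <= L * enorm (cldom_val x - cldom_val y).
  exact: K_lipschitz.
have kc (h : curve Omega_neq0) : continuous h ->
    continuous (fun t : R => kQ K Q (rplus t) (h (rplus t))).
  move=> ch t.
  pose F (t : R) := (push_eval (rplus t) Q, h (rplus t)).
  apply: (@continuous_comp _ _ _ F (fun p => K p.1 p.2)); last exact: K_continuous.
  have hc : h (rplus s) @[s --> t] --> h (rplus t).
    by apply: continuous_comp; [exact: continuous_rplus|exact: ch].
  exact: (cvg_pair (continuous_push_eval (x := t)) hc).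
apply: (Opt_limit Gamma_closed D0 geo Kmin_gt0 kb L_gt0 kL kc) => n e e0.
have := near_path g n e0.
rewrite nbhsE => -[V [oV Vg] sub].
have QV := sg V oV Vg.
apply: contrapT => noh.
have : Q.-negligible (V : set (borel (paths Omega_neq0))).
  apply: negligibleS QO => h Vh /= Oh; apply: noh.
  by exists (path_fun h) => //; exact: sub.
have mV : measurable (V : set (borel (paths Omega_neq0))) by exact: sub_sigma_algebra.
move=> /(measure_negligible mV) QV0.
by move: QV; rewrite QV0 ltxx.
Qed.
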